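(* Let $m\ge 1$ be an integer and let $N_1<N_2$ be integers. A sequence $E\subset [N_1,N_2]$ consisting of distinct points is a phaseless sampling sequence for $V_m|_{[N_1,N_2]}$ if and only if it satisfies all of the following: $$\# E \ge 2(N_2-N_1+m)-1,$$ $$\# (E\cap [N_1, N_1+k)) \ge 2k+m-1 \quad\text{for all integers } 1\le k\le N_2-N_1,$$ $$\# (E\cap (N_2-k, N_2]) \ge 2k+m-1 \quad\text{for all integers } 1\le k\le N_2-N_1,$$ $$\# (E\cap(n_1,n_2)) \ge 2(n_2-n_1)-1 \quad\text{for all integers } N_1\le n_1<n_2\le N_2.$$ Moreover, if $E\subset[N_1,N_2]$ is a sequence of distinct points with $\# E \ge 2(N_2-N_1+m)-1$, with $\# (E\cap [N_1, N_1+k)) \ge 2k+m-1$ and $\# (E\cap (N_2-k, N_2]) \ge 2k+m-1$ for all integers $1\le k\le N_2-N_1$, and with $\# (E\cap(n_1,n_2)) \ge 2(n_2-n_1)-1$ for all integers $N_1\le n_1<n_2\le N_2$, and if $|f_1(x)|=|f_2(x)|$ for all $x\in E$ for some $f_1,f_2\in V_m$, then $|f_1(x)|=|f_2(x)|$ for all $x\in[N_1,N_2]$.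
   Context: For an integer $m\ge 1$, $\varphi_m=\chi_{[0,1]}*\cdots*\chi_{[0,1]}$ ($m+1$ factors) is the B-spline of degree $m$ (supported on $[0,m+1]$), and $V_m=\{\sum_{n\in\mathbb Z}c_n\varphi_m(\cdot-n): c_n\in\mathbb R\}$ (arbitrary real coefficient sequences; the sum is locally finite). For integers $N_1<N_2$, $V_m|_{[N_1,N_2]}$ is the space of functions $g\cdot\chi_{[N_1,N_2]}$ with $g\in V_m$. A function $f$ in a function space $H$ is separable if $f=f_1+f_2$ for some $f_1,f_2\in H\setminus\{0\}$ with $f_1(x)f_2(x)=0$ for all $x$; otherwise it is nonseparable. A sequence $E\subset[N_1,N_2]$ of distinct points is a (local) phaseless sampling sequence for $V_m|_{[N_1,N_2]}$ if any nonseparable $f\in V_m|_{[N_1,N_2]}$ is determined up to a sign by its unsigned sampled values on $E$, i.e. whenever $f\in V_m|_{[N_1,N_2]}$ is nonseparable and $g\in V_m|_{[N_1,N_2]}$ satisfies $|g(x)|=|f(x)|$ for all $x\in E$, then $g=f$ or $g=-f$. $\#E$ denotes the cardinality of $E$. *)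

(* Defs.v *)
From HB Require Import structures.
From mathcomp Require Import all_boot all_order all_algebra.
From mathcomp Require Import all_classical all_reals all_analysis.
Import Order.TTheory GRing.Theory Num.Theory.
Import numFieldNormedType.Exports.

Set Implicit Arguments.
Unset Strict Implicit.
Unset Printing Implicit Defensive.

Local Open Scope classical_set_scope.
Local Open Scope ring_scope.

Definition convolution (R : realType) (f g : R -> R) : R -> R :=
  fun x => \int[lebesgue_measure]_(y in [set: R]) (f y * g (x - y)).

Definition bspline (R : realType) (m : nat) : R -> R :=
  iter m (fun f : R -> R => convolution f \1_(`[0, 1])) \1_(`[0, 1]).

(* [\sum_(n \in A)] is the sum over the finite support of the summand (and is 0
   when that support is infinite).  Here, for each [x], only the finitely many
   [n] with [x - n] in [0, m + 1] can contribute, so [c] is arbitrary. *)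
Definition spline_space (R : realType) (m : nat) : set (R -> R) :=
  [set g | exists c : int -> R,
     g = fun x => \sum_(n \in [set: int]) (c n * bspline m (x - n%:~R))].

Definition spline_space_on (R : realType) (m : nat) (N1 N2 : int)
    : set (R -> R) :=
  [set f | exists2 g : R -> R, spline_space m g &
     f = fun x => g x * \1_(`[N1%:~R, N2%:~R]) x].

Definition separable (R : realType) (H : set (R -> R)) (f : R -> R) : Prop :=
  exists f1 f2 : R -> R,
    [/\ (H `\ cst 0) f1, (H `\ cst 0) f2, f = f1 \+ f2 &
        forall x, f1 x * f2 x = 0].

Definition phaseless_sampling (R : realType) (H : set (R -> R)) (E : set R)
    : Prop :=
  forall f g : R -> R, H f -> ~ separable H f -> H g ->
    (forall x, E x -> `|g x| = `|f x|) -> g = f \/ g = \- f.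

(* [counting A] is the number of elements of [A], +oo if [A] is infinite. *)
Definition card_ge (R : realType) (A : set R) (z : int) : Prop :=
  ((z%:~R : R)%:E <= counting A)%E.

Definition sampling_conditions (R : realType) (m : nat) (N1 N2 : int)
    (E : set R) : Prop :=
  [/\ card_ge E (2 * (N2 - N1 + m%:Z) - 1),
      forall k : int, 1 <= k <= N2 - N1 ->
        card_ge (E `&` `[N1%:~R, (N1 + k)%:~R[) (2 * k + m%:Z - 1),
      forall k : int, 1 <= k <= N2 - N1 ->
        card_ge (E `&` `](N2 - k)%:~R, N2%:~R]) (2 * k + m%:Z - 1) &
      forall n1 n2 : int, N1 <= n1 -> n1 < n2 -> n2 <= N2 ->
        card_ge (E `&` `]n1%:~R, n2%:~R[) (2 * (n2 - n1) - 1)].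

(* Main.v *)
Require Import Defs.
From HB Require Import structures.
From mathcomp Require Import all_boot all_order all_algebra.
From mathcomp Require Import all_classical all_reals all_analysis.
From mathcomp Require Import measurable_realfun.
From mathcomp Require Import zify ring lra.
Import Order.TTheory GRing.Theory Num.Theory.
Import numFieldNormedType.Exports.

Set Implicit Arguments.
Unset Strict Implicit.
Unset Printing Implicit Defensive.

Local Open Scope classical_set_scope.
Local Open Scope ring_scope.

(** Write m for the degree, and u = f1 + f2, v = f1 - f2.
    Then |f1| = |f2| at x exactly when u v = 0 at x, and f1 splits as
    u/2 + v/2; so both sampling statements are about pairs (u, v) of splines
    whose product vanishes on E.

    Zero counting.  Let u have coefficients supported in [p, q], and suppose
    that u vanishes identically on no cell [j, j+1] inside its support
    [p, q+m+1].  Then u has at most q - p zeros in the interior of the support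
    ([zero_count]).  Between consecutive zeros, the end points included, u' takes
    both signs, and each further differentiation gains one sign alternation
    because all derivatives vanish outside the support; after m steps one has
    a step function with at most q - p + m + 1 steps, which bounds the number
    of alternations.  No derivative is needed for this: the increments of a
    spline are integrals of the spline of one degree less whose coefficients
    are the differences, and a positive increment forces that spline to be
    positive somewhere ([spl_incr]).

    Sufficiency.  If u v is not 0 somewhere on [N1, N2], take a maximal block
    [a, b] of cells on each of which neither u nor v vanishes identically.  At
    an end of the block inside ]N1, N2[ one of u, v vanishes on the adjacent
    cell, and thus loses m coefficients there.  Adding the two zero counts
    gives at most 2 (b - a) - 2 zeros, plus m for each end of the block that is
    an end of [N1, N2]; the sampling conditions provide one point more in each
    of the four cases ([sampled_product_vanishes]).

    Necessity.  If some condition fails, one looks for nonzero u and v with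
    u v = 0 on E and u + e v nonseparable for a suitable e; then u + e v and
    u - e v have the same unsigned samples.  A spline is nonseparable as soon
    as its coefficients have no m consecutive zeros between two nonzero ones
    ([gapless_nonseparable]).  A spline with l + 1 consecutive coefficients can
    be made to vanish at l given points, and zero counting, applied to a maximal
    piece of it without such gaps, shows that it has no gap and nonzero extreme
    coefficients whenever the l points interlace with the knots
    ([interlaced_gapless], in the spirit of the Schoenberg-Whitney theorem).
    For a failing condition on a shortest interval, the conditions on shorter
    intervals locate the sorted sample points so precisely that they can be
    dealt out to u and v in an interlacing way ([phaseless_inner],
    [phaseless_left], [phaseless_right], [phaseless_total]). *)

(** * Integrals over half-open intervals *)

(** This class contains the step functions, is preserved by the moving averages
    that raise the degree, and consists of functions that are integrable on
    bounded intervals; it is the setting for all splines below. *)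
Definition locbounded (R : realType) (f : R -> R) : Prop :=
  measurable_fun [set: R] f /\
  forall a b : R, exists M, forall x, a <= x <= b -> `|f x| <= M.

(** With the right end left out, an integral up to a knot does not see the
    coefficient of the step that begins there. *)
Definition integ (R : realType) (f : R -> R) (a b : R) : R :=
  \int[lebesgue_measure]_(t in `[a, b[) f t.

Section Integ.
Variable R : realType.
Implicit Types (f g : R -> R) (a b c x y : R).
Notation mu := (@lebesgue_measure R).

Lemma locbounded_integrable f a b : locbounded f ->
  mu.-integrable `[a, b[ (EFin \o f).
Proof.
move=> [mf bf]; apply: measurable_bounded_integrable => //=.
- rewrite lebesgue_measure_itv /=; case: ifP => // _.
  by rewrite -EFinB ltry.
- exact: measurable_funTS.
- have [M hM] := bf a b.
  exists M; split; first exact: num_real.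
  move=> N MN x /=; rewrite in_itv /= => /andP[ax xb].
  by rewrite (le_trans (hM x _)) ?ax ?(ltW xb) // ltW.
Qed.

Lemma integ_cst r a b : a <= b -> integ (fun=> r) a b = r * (b - a).
Proof.
move=> ab; rewrite /integ Rintegral_cst //= lebesgue_measure_itv /= lte_fin.
case: ltP => //= ba; have -> : a = b by apply/le_anti; rewrite ab.
by rewrite subrr.
Qed.

Lemma eq_integ f g a b : (forall t, a <= t < b -> f t = g t) ->
  integ f a b = integ g a b.
Proof.
by move=> fg; apply: eq_Rintegral => t; rewrite inE /= in_itv /=; apply: fg.
Qed.

Lemma le_integ f g a b : locbounded f -> locbounded g ->
  (forall t, a <= t < b -> f t <= g t) -> integ f a b <= integ g a b.
Proof.
move=> nf ng fg; apply: le_Rintegral => //; try exact: locbounded_integrable.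
Qed.

Lemma integ_cat f a b c : locbounded f -> a <= b -> b <= c ->
  integ f a c = integ f a b + integ f b c.
Proof.
move=> nf ab bc; rewrite /integ (@itv_bndbnd_setU _ _ _ (BLeft b)) ?bnd_simp //.
rewrite Rintegral_setU //.
  by rewrite -itv_bndbnd_setU ?bnd_simp //; exact: locbounded_integrable.
apply/disj_setPS => y [/=]; rewrite 2!in_itv/= => /andP[_ yx] /andP[].
by rewrite leNgt yx.
Qed.

Lemma locbounded_scale r f : locbounded f -> locbounded (fun t => r * f t).
Proof.
move=> [mf bf]; split; first exact: measurable_funM.
move=> a b; have [M hM] := bf a b; exists (`|r| * M) => x xab.
by rewrite normrM ler_wpM2l // hM.
Qed.

Lemma locbounded_add f g :
  locbounded f -> locbounded g -> locbounded (fun t => f t + g t).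
Proof.
move=> [mf bf] [mg bg]; split; first exact: measurable_funD.
move=> a b; have [M hM] := bf a b; have [N hN] := bg a b.
exists (M + N) => x xab.
by rewrite (le_trans (ler_normD _ _)) // lerD ?hM ?hN.
Qed.

Lemma integ_lin r s f g a b : locbounded f -> locbounded g ->
  integ (fun t => r * f t + s * g t) a b = r * integ f a b + s * integ g a b.
Proof.
move=> nf ng; rewrite /integ RintegralD // ?RintegralZl //.
- exact: locbounded_integrable.
- exact: locbounded_integrable.
- exact/locbounded_integrable/locbounded_scale.
- exact/locbounded_integrable/locbounded_scale.
Qed.

Lemma locbounded_cst r : locbounded (fun _ : R => r).
Proof. by split=> // a b; exists `|r|. Qed.

Lemma integ_bound f a b M : locbounded f -> a <= b ->
  (forall t, a <= t < b -> `|f t| <= M) -> `|integ f a b| <= M * (b - a).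
Proof.
move=> nf ab fM; rewrite ler_norml.
rewrite -mulNr -!integ_cst // !le_integ //; try exact: locbounded_cst;
  by move=> t /fM; rewrite ler_norml => /andP[].
Qed.

Lemma locbounded_shift f r : locbounded f -> locbounded (fun t => f (t - r)).
Proof.
move=> [mf bf]; split.
  by apply: measurableT_comp => //; exact: measurable_funB.
move=> a b; have [M hM] := bf (a - r) (b - r).
by exists M => x xab; apply: hM; rewrite !lerD2r.
Qed.

(** Translation invariance of Lebesgue measure follows from its uniqueness, as
    the image measure agrees with it on half-open intervals. *)
Lemma integ_shift f r a b : locbounded f ->
  integ (fun t => f (t - r)) a b = integ f (a - r) (b - r).
Proof.
move=> nf; pose phi : measurableTypeR R -> measurableTypeR R := fun t => t - r.
have mphi : measurable_fun [set: measurableTypeR R] phi by exact: measurable_funB.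
have phiE (c d : R) (b1 b2 : bool) : phi @^-1` [set` Interval (BSide b1 c) (BSide b2 d)] =
    [set` Interval (BSide b1 (c + r)) (BSide b2 (d + r))].
  apply/seteqP; split=> t /=; rewrite /phi !in_itv /=;
  by case: b1; case: b2; rewrite /= ?lerBrDr ?ltrBrDr ?lerBlDr ?ltrBlDr.
rewrite /integ /Rintegral; congr fine.
have -> : `[a, b[%classic = phi @^-1` `[a - r, b - r[%classic.
  by rewrite phiE !subrK.
rewrite -(@integral_pushforward _ _ _ _ R phi mphi mu `[a - r, b - r[%classic
   (EFin \o f)) //; first last.
- rewrite phiE !subrK; have := locbounded_integrable a b (locbounded_shift r nf).
  by apply: eq_integrable.
- by apply/measurable_EFinP; case: nf.
apply: eq_measure_integral => A mA _; apply/esym.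
apply: (lebesgue_measure_unique (mu := pushforward mu phi)) => // X.
move=> [[c d] _ <-] /=; rewrite /pushforward phiE !lebesgue_measure_itv /=.
by rewrite !lte_fin ltrD2r -!EFinD opprD addrACA subrr addr0.
Qed.

End Integ.

(** * Cardinal splines as iterated moving averages *)

(** The spline with coefficients c, of degree k: the sum over n of
    c n times the B-spline of degree k translated by n.  A moving average
    commutes with this sum, so starting from the step function with values c the
    recursion makes sense for arbitrary coefficients, with no series. *)
Fixpoint spl (R : realType) (k : nat) (c : int -> R) (x : R) : R :=
  if k is k'.+1 then integ (spl k' c) (x - 1) x else c (Num.floor x).

Definition delta (R : realType) (c : int -> R) : int -> R :=
  fun n => c n - c (n - 1).

(** Right continuity is what step functions and continuous functions share; it
    suffices to pass from the sign of a function at a point to the sign of an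
    integral. *)
Definition right_cont (R : realType) (f : R -> R) : Prop :=
  forall t e, 0 < e ->
    exists2 d, 0 < d & forall s, t <= s < t + d -> `|f s - f t| < e.

Section Spl.
Variable R : realType.
Implicit Types (f g : R -> R) (a b x y t : R) (c d : int -> R) (k : nat).
Implicit Types (i j n : int).

(** Both sides come from cutting the integral over [x - 1, y[ once at x and once
    at y - 1. *)
Lemma moving_average_diff f x y : locbounded f -> x <= y ->
  integ f (y - 1) y - integ f (x - 1) x =
  integ (fun t => f t - f (t - 1)) x y.
Proof.
move=> nf xy; have H1 : integ f (x - 1) y = integ f (x - 1) x + integ f x y.
  by apply: integ_cat => //; rewrite gerBl.
have H2 : integ f (x - 1) y = integ f (x - 1) (y - 1) + integ f (y - 1) y.
  by apply: integ_cat => //; rewrite ?gerBl // lerD2r.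
have -> : integ (fun t => f t - f (t - 1)) x y =
    1 * integ f x y + (-1) * integ (fun t => f (t - 1)) x y.
  rewrite -integ_lin //; last exact: locbounded_shift.
  by apply: eq_integ => t _; rewrite mul1r mulN1r.
rewrite integ_shift //; lra.
Qed.

(** By [moving_average_diff] the moving average is Lipschitz near x, with twice a
    local bound of f as constant. *)
Lemma continuous_moving_average f : locbounded f ->
  continuous (fun x => integ f (x - 1) x).
Proof.
move=> nf x; have [_ bf] := nf.
have [M hM] := bf (x - 2) (x + 1).
have M0 : 0 <= M by rewrite (le_trans _ (hM x _)) //; apply/andP; split; lra.
have key y z : x - 1 <= y <= z -> z <= x + 1 ->
    `|integ f (z - 1) z - integ f (y - 1) y| <= (M + M) * (z - y).
  move=> /andP[xy yz] zx; rewrite moving_average_diff // integ_bound //.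
    have := locbounded_add nf (locbounded_scale (-1) (locbounded_shift 1 nf)).
    by under eq_fun do rewrite mulN1r.
  move=> t /andP[yt tz]; rewrite (le_trans (ler_normB _ _)) // lerD ?hM //;
    by apply/andP; split; lra.
apply/cvgrPdist_lt => e e0.
have M1 : 0 < M + M + 1 by lra.
near=> z.
have zd : `|x - z| < Num.min 1 (e / (M + M + 1)).
  by near: z; apply: cvgr_dist_lt; rewrite ?lt_min ?ltr01 ?divr_gt0.
move: zd; rewrite lt_min => /andP[z1]; rewrite ltr_pdivlMr // => ze.
have [xz|zx] := leP x z.
  rewrite distrC (le_lt_trans (key x z _ _)) //.
  - by apply/andP; split; lra.
  - by move: z1; rewrite ler0_norm; lra.
  - move: ze; rewrite ler0_norm ?subr_le0 //; nra.
rewrite (le_lt_trans (key z x _ _)) //.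
- by apply/andP; split; move: z1; rewrite ger0_norm; lra.
- by lra.
- move: ze; rewrite gtr0_norm ?subr_gt0 //; nra.
Unshelve. all: by end_near.
Qed.

(** The preimage of a set is a countable union of cells [n, n + 1[. *)
Lemma locbounded_step c : locbounded (fun x : R => c (Num.floor x)).
Proof.
split.
  move=> _ B mB; rewrite setTI.
  have -> : (fun x : R => c (Num.floor x)) @^-1` B =
      \bigcup_n [set x : R | B (c n) /\ n%:~R <= x < (n + 1)%:~R].
    apply/seteqP; split=> x /=.
      by move=> Bc; exists (Num.floor x) => //; split=> //; apply: floor_itv.
    by move=> [n _ [Bn /floor_def ->]].
  apply: countable_bigcupT_measurable => // n.
  have [Bn|nBn] := pselect (B (c n)).
    rewrite [X in measurable X](_ : _ = `[n%:~R, (n + 1)%:~R[%classic) //.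
    apply/seteqP; split=> x /=; rewrite in_itv /=; first by case.
    by move=> ->.
  rewrite [X in measurable X](_ : _ = set0) //.
  by apply/seteqP; split=> x //= [].
move=> a b.
exists (\sum_(i < `|Num.floor b - Num.floor a|.+1) `|c (Num.floor a + i%:Z)|).
move=> x /andP[ax xb].
have h1 : Num.floor a <= Num.floor x by apply: le_floor.
have h2 : Num.floor x <= Num.floor b by apply: le_floor.
have iP : (`|Num.floor x - Num.floor a| < `|Num.floor b - Num.floor a|.+1)%N.
  by lia.
rewrite (bigD1 (Ordinal iP)) //=.
have -> : Num.floor a + `|Num.floor x - Num.floor a|%N%:Z = Num.floor x by lia.
by rewrite lerDl sumr_ge0.
Qed.

Lemma locbounded_continuous f : continuous f -> locbounded f.
Proof.
move=> cf; split; first exact: continuous_measurable_fun.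
move=> a b; have [ab|ba] := leP a b; last first.
  by exists 0 => x /andP[ax xb]; move: ba; rewrite ltNge (le_trans ax xb).
have cfab : {within `[a, b], continuous f} by exact: continuous_subspaceT.
have [u _ hu] := EVT_max ab cfab; have [v _ hv] := EVT_min ab cfab.
exists (`|f u| + `|f v|) => x xab.
have := hu x; have := hv x; rewrite in_itv /= xab => /(_ isT) vx /(_ isT) xu.
rewrite ler_norml; apply/andP; split.
  have := ler_norm (- f v); rewrite normrN; have := normr_ge0 (f u); lra.
have := ler_norm (f u); have := normr_ge0 (f v); lra.
Qed.

Lemma locbounded_spl k c : locbounded (spl k c).
Proof.
elim: k => [|k IH] /=; first exact: locbounded_step.
exact/locbounded_continuous/continuous_moving_average.
Qed.

Lemma continuous_spl k c : continuous (spl k.+1 c).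
Proof. exact/continuous_moving_average/locbounded_spl. Qed.

Lemma right_cont_spl k c : right_cont (spl k c).
Proof.
case: k => [|k] t e e0.
  exists ((Num.floor t + 1)%:~R - t); first by rewrite subr_gt0 floorD1_gt.
  move=> s /= /andP[ts]; rewrite addrC subrK => st.
  rewrite (@floor_def _ s (Num.floor t)) ?subrr ?normr0 //.
  by rewrite st andbT (le_trans _ ts) // floor_le.
have /cvgrPdist_lt /(_ e e0) := @continuous_spl k c t.
move=> /nbhs_ballP[d /= d0 hd].
exists d => // s /andP[ts std]; rewrite distrC; apply: hd.
by rewrite /ball /= distrC ger0_norm ?subr_ge0 // ltrBlDl.
Qed.

Lemma spl_lin k a b c d x :
  spl k (fun n => a * c n + b * d n) x = a * spl k c x + b * spl k d x.
Proof.
elim: k x => [//|k IH] x /=.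
rewrite -integ_lin; try exact: locbounded_spl.
by apply: eq_integ => t _; exact: IH.
Qed.

Lemma spl_shift k c n x : spl k (fun i => c (i - n)) x = spl k c (x - n%:~R).
Proof.
elim: k x => [|k IH] x /=.
  congr c; symmetry; apply: floor_def; have := floor_itv x.
  by rewrite addrAC !intrB lerD2r ltrD2r.
rewrite addrAC -(integ_shift _ _ _ (locbounded_spl k c)).
by apply: eq_integ => t _; exact: IH.
Qed.

Lemma spl_delta k c x : spl k (delta c) x = spl k c x - spl k c (x - 1).
Proof.
have -> : delta c = (fun n => 1 * c n + (-1) * (fun m => c (m - 1)) n).
  by apply/funext => n; rewrite mul1r mulN1r.
by rewrite spl_lin spl_shift mul1r mulN1r.
Qed.

(** The integral form of the rule that differentiating a spline lowers its degree
    and takes differences of its coefficients. *)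
Lemma spl_increment k c x y : x <= y ->
  spl k.+1 c y - spl k.+1 c x = integ (spl k (delta c)) x y.
Proof.
move=> xy; rewrite /= moving_average_diff //; last exact: locbounded_spl.
by apply: eq_integ => t _; rewrite spl_delta.
Qed.

(** The value at x is an iterated average over [x - k, x], which involves k + 1
    cells only. *)
Lemma spl_local k c d j x : (forall n, j - k%:Z <= n <= j -> c n = d n) ->
  j%:~R <= x < (j + 1)%:~R -> spl k c x = spl k d x.
Proof.
elim: k j x => [|k IH] j x cd jx /=.
  by rewrite (floor_def jx) cd // subr0 lexx.
apply: eq_integ => t /andP[xt tx].
have [jt|tj] := leP j%:~R t.
  apply: (IH j); first by move=> n nj; apply: cd; lia.
  by rewrite jt (lt_trans tx) //; case/andP: jx.
apply: (IH (j - 1)); first by move=> n nj; apply: cd; lia.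
rewrite subrK tj andbT intrB mulr1z; move: jx => /andP[jx _]; lra.
Qed.

(** In positive degree the cell can be closed: the average over [j, j + 1[ does
    not involve the coefficient j + 1. *)
Lemma spl_local_closed k c d j x :
  (forall n, j - k.+1%:Z <= n <= j -> c n = d n) ->
  j%:~R <= x <= (j + 1)%:~R -> spl k.+1 c x = spl k.+1 d x.
Proof.
move=> cd /andP[jx xj] /=; apply: eq_integ => t /andP[xt tx].
have [jt|tj] := leP j%:~R t.
  apply: (@spl_local _ _ _ j); first by move=> n nj; apply: cd; lia.
  by rewrite jt (lt_le_trans tx).
apply: (@spl_local _ _ _ (j - 1)); first by move=> n nj; apply: cd; lia.
by rewrite subrK tj andbT intrB mulr1z; lra.
Qed.

Lemma spl_local_left k c d j x : (forall n, n <= j -> c n = d n) ->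
  x <= (j + 1)%:~R -> spl k.+1 c x = spl k.+1 d x.
Proof.
move=> cd xj; have [jx|xj'] := leP j%:~R x.
  by apply: (@spl_local_closed _ _ _ j); rewrite ?jx // => n nj; apply: cd; lia.
apply: (@spl_local _ _ _ (Num.floor x)); last exact: floor_itv.
move=> n nx; apply: cd.
suff : Num.floor x < j by lia.
by rewrite floor_lt_int.
Qed.

Lemma spl_local_right k c d j x : (forall n, j <= n -> c n = d n) ->
  (j + k%:Z)%:~R <= x -> spl k c x = spl k d x.
Proof.
move=> cd jx; apply: (@spl_local _ _ _ (Num.floor x)); last exact: floor_itv.
move=> n nx; apply: cd.
have jf : j + k%:Z <= Num.floor x by rewrite floor_ge_int.
by lia.
Qed.

Lemma spl0 k x : spl k (fun=> 0) x = 0.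
Proof.
have -> : (fun _ : int => 0 : R) = (fun n => 0 * 0 + 0 * 0).
  by apply/funext => n; rewrite mul0r addr0.
by rewrite (@spl_lin _ _ _ (fun=> 0) (fun=> 0)) !mul0r addr0.
Qed.

(** Partition of unity. *)
Lemma spl_cst k r x : spl k (fun=> r) x = r.
Proof.
elim: k x => [//|k IH] x /=.
rewrite (@eq_integ _ _ (fun=> r)); last by move=> t _; exact: IH.
by rewrite integ_cst ?gerBl // opprB addrC subrK mulr1.
Qed.

Lemma integ_gt0 f x y s : locbounded f -> right_cont f -> x <= s < y -> 0 < f s ->
  exists s' t', [/\ x <= s', s' < t', t' <= y & 0 < integ f s' t'].
Proof.
move=> nf rf /andP[xs sy] fs; have [|d d0 hd] := rf s (f s / 2).
  by rewrite divr_gt0.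
pose t := Num.min y (s + d).
have st : s < t by rewrite lt_min sy ltrDl.
exists s, t; split=> //; first by rewrite /t ge_min lexx.
have : integ (fun=> f s / 2) s t <= integ f s t.
  apply: le_integ => //; first exact: locbounded_cst.
  move=> u /andP[su ut]; have := hd u; rewrite su (lt_le_trans ut) ?ge_min ?lexx ?orbT //.
  by move=> /(_ isT); rewrite ltr_norml => /andP[? _]; lra.
apply: lt_le_trans; rewrite integ_cst ?(ltW st) //.
by rewrite mulr_gt0 ?subr_gt0 // divr_gt0.
Qed.

(** Local linear independence of the translated B-splines.  All increments on
    [x, y[ vanish, hence so does the derivative there, and by induction the
    differences of c vanish on the window; so c is constant on the window, and
    the constant is a value of the spline by the partition of unity. *)
Lemma spl_unique k c j x y : j%:~R <= x -> x < y -> y <= (j + 1)%:~R ->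
  (forall t, x <= t < y -> spl k c t = 0) ->
  forall n, j - k%:Z <= n <= j -> c n = 0.
Proof.
elim: k c => [|k IH] c jx xy yj cx n nj.
  have -> : n = j by lia.
  have := cx x; rewrite lexx xy /= => /(_ isT).
  by rewrite (@floor_def _ x j) // jx (lt_le_trans xy).
have dc0 t : x <= t < y -> spl k (delta c) t = 0.
  have H d : (forall t, x <= t < y -> spl k.+1 d t = 0) ->
    forall t, x <= t < y -> spl k (delta d) t <= 0.
    move=> dx s sxy; rewrite leNgt; apply/negP => ps.
    have [s' [t' [xs st ty]]] := integ_gt0 (locbounded_spl k (delta d))
      (@right_cont_spl k (delta d)) sxy ps.
    rewrite -spl_increment ?(ltW st) //.
    have [ty'|] := ltP t' y.
      by rewrite !dx ?subrr ?ltxx // ?xs ?(lt_trans st) // ty' (le_trans xs) // ltW.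
    move=> yt; have {yt}ty : t' = y by apply/le_anti; rewrite ty yt.
    (* At t' = y the hypothesis is silent, and continuity gives the value. *)
    suff dy0 : spl k.+1 d y = 0.
      by rewrite ty dy0 dx ?subrr ?ltxx // xs -ty.
    apply/eqP; case: eqP => // /eqP dy.
    have /cvgrPdist_lt /(_ `|spl k.+1 d y|) := @continuous_spl k d y.
    rewrite normr_gt0 => /(_ dy) /nbhs_ballP[e /= e0 he].
    pose u := Num.max x (y - e / 2).
    have uy : u < y by rewrite gt_max xy /=; lra.
    have ule : y - e / 2 <= u by rewrite le_max lexx orbT.
    have uball : ball y e u.
      by rewrite /ball /= gtr0_norm ?subr_gt0 //; lra.
    have : `|spl k.+1 d y - spl k.+1 d u| < `|spl k.+1 d y| := he u uball.
    by rewrite (dx u) ?subr0 ?ltxx // uy le_max lexx.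
  move=> txy; apply/le_anti/andP; split; first exact: H.
  have := H (fun n => (-1) * c n + 0 * c n).
  have -> : delta (fun n => (-1) * c n + 0 * c n) =
      (fun n => (-1) * delta c n + 0 * delta c n).
    by apply/funext => i; rewrite /delta; lra.
  move=> /(_ _ t txy); rewrite spl_lin mulN1r mul0r addr0 oppr_le0; apply=> s sxy.
  by rewrite spl_lin cx // mulr0 mul0r addr0.
have dc := IH _ jx xy yj dc0.
have cj i : j - k.+1%:Z <= i <= j -> c i = c j.
  move=> ij; have [p pE] : exists p : nat, i = j - p%:Z.
    by exists `|j - i|%N; lia.
  elim: p i ij pE => [|p IHp] i ij pE; subst i; first by rewrite subr0.
  rewrite -(IHp (j - p%:Z)) //; last by lia.
  have := dc (j - p%:Z); rewrite /delta => H.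
  have -> : j - p.+1%:Z = j - p%:Z - 1 by lia.
  by apply/esym/eqP; rewrite -subr_eq0 H //; lia.
have := cx x; rewrite lexx xy /= => /(_ isT).
rewrite -/(spl k.+1 c x) (@spl_local _ _ (fun=> c j) j x) //.
- by rewrite spl_cst => <-; apply: cj.
- by rewrite jx (lt_le_trans xy).
Qed.

(** This replaces the mean value theorem, and also covers degree 1, whose
    derivative has jumps.  The sign is carried by the factor [sg], so that
    increasing and decreasing splines are treated together. *)
Lemma spl_incr k c (sg : R) x y : x < y ->
  sg * spl k.+1 c x < sg * spl k.+1 c y ->
  exists t, [/\ x < t, t < y & 0 < sg * spl k (delta c) t].
Proof.
move=> xy; rewrite -subr_gt0 -mulrBr spl_increment ?(ltW xy) // => I0.
pose f := spl k (delta c).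
have [t /andP[xt ty] ft] : exists2 t, x <= t < y & 0 < sg * f t.
  apply: contrapT => nex.
  suff : integ (fun t => sg * f t + 0 * f t) x y <= integ (fun=> 0) x y.
    rewrite integ_lin; try exact: locbounded_spl.
    by rewrite mul0r addr0 integ_cst ?mul0r ?(ltW xy) // leNgt I0.
  apply: le_integ.
  - by apply: locbounded_add; exact/locbounded_scale/locbounded_spl.
  - exact: locbounded_cst.
  move=> t txy; rewrite mul0r addr0 leNgt; apply/negP => ft.
  by apply: nex; exists t.
have [|d d0 hd] := @right_cont_spl k (delta c) t `|f t|.
  by rewrite normr_gt0; apply: contraTneq ft => ->; rewrite mulr0 ltxx.
pose s := Num.min (t + d / 2) ((t + y) / 2).
have ts : t < s by rewrite lt_min; apply/andP; split; lra.
exists s; split.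
- exact: le_lt_trans ts.
- by rewrite gt_min; apply/orP; right; lra.
- have := hd s; rewrite (ltW ts) gt_min; have -> : t + d / 2 < t + d by lra.
  move=> /(_ isT); rewrite -/f; case: (ltP 0 (f t)) => f0.
    rewrite (gtr0_norm f0) ltr_norml => /andP[h _].
    have sg0 : 0 < sg by rewrite -(pmulr_lgt0 _ f0).
    by rewrite mulr_gt0 //; lra.
  have {}f0 : f t < 0.
    rewrite lt_neqAle f0 andbT; apply: contraTneq ft => ->.
    by rewrite mulr0 ltxx.
  rewrite (ltr0_norm f0) ltr_norml => /andP[_ h].
  have sg0 : sg < 0 by rewrite -(nmulr_lgt0 _ f0).
  by rewrite nmulr_rgt0 //; lra.
Qed.

End Spl.

(** * Counting the zeros of a spline *)

Lemma int_min (P : int -> Prop) (lo n0 : int) :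
  (forall n, P n -> lo <= n) -> P n0 ->
  exists2 p, P p & forall n, P n -> p <= n.
Proof.
move=> Plo Pn0; have ex : exists k : nat, `[< P (lo + k%:Z) >].
  exists `|n0 - lo|%N; apply/asboolP.
  by have := Plo _ Pn0 => ?; have -> : lo + `|n0 - lo|%N%:Z = n0 by lia.
have [k /asboolP Pk mink] := ex_minnP ex.
exists (lo + k%:Z) => // n Pn; have := Plo _ Pn => ?.
have := mink `|n - lo|%N; have -> : lo + `|n - lo|%N%:Z = n by lia.
by move=> /(_ (asboolT Pn)); lia.
Qed.

Lemma int_max (P : int -> Prop) (hi n0 : int) :
  (forall n, P n -> n <= hi) -> P n0 ->
  exists2 q, P q & forall n, P n -> n <= q.
Proof.
move=> Phi Pn0.
have [||p Pp pmin] := @int_min (fun n => P (- n)) (- hi) (- n0).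
- by move=> n /Phi; lia.
- by rewrite opprK.
by exists (- p) => // n Pn; have := pmin (- n); rewrite opprK => /(_ Pn); lia.
Qed.

(** The function e f is positive, negative, positive, and so on, along the
    increasing sequence ts of points beyond lo. *)
Fixpoint alternates (R : realType) (f : R -> R) (e lo : R) (ts : seq R) : Prop :=
  if ts is t :: ts' then
    [/\ lo < t, 0 < e * f t & alternates f (- e) t ts']
  else True.

Section ZeroCount.
Variable R : realType.
Implicit Types (f : R -> R) (x y t e lo : R) (c : int -> R) (k : nat).
Implicit Types (i j n p q : int) (zs ts : seq R).

Lemma alternates_weaken f e lo lo' ts : lo' <= lo ->
  alternates f e lo ts -> alternates f e lo' ts.
Proof. by case: ts => //= t ts le [lt ? ?]; split=> //; apply: le_lt_trans lt. Qed.

(** Each sign change of the spline forces a sign of its derivative, and the return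
    to 0 at the right end forces one sign more. *)
Lemma alternates_diff_from k c e lo hi ts :
  (forall x, hi <= x -> spl k.+1 c x = 0) ->
  e * spl k.+1 c lo < 0 -> alternates (spl k.+1 c) e lo ts ->
  exists2 ts', alternates (spl k (delta c)) e lo ts' & size ts' = (size ts).+1.
Proof.
move=> chi; elim: ts e lo => [|t ts IH] e lo elo.
  move=> _; have lohi : lo < hi.
    by rewrite ltNge; apply: contraTN elo => /chi ->; rewrite mulr0 ltxx.
  have [|t [lot _ et]] := @spl_incr R k c e lo hi lohi.
    by rewrite (chi hi) ?mulr0.
  by exists [:: t].
move=> [lot et ats]; have [|t1 [lot1 t1t et1]] := @spl_incr R k c e lo t lot.
  exact: lt_trans et.
have [|ts' ats' sz] := IH (- e) t _ ats; first by rewrite mulNr oppr_lt0.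
exists (t1 :: ts'); last by rewrite /= sz.
by split=> //; apply: alternates_weaken ats'; apply: ltW.
Qed.

(** Rolle's theorem for sign alternations: when the spline vanishes at both ends,
    its derivative alternates once more. *)
Lemma alternates_diff k c e lo hi t ts :
  (forall x, hi <= x -> spl k.+1 c x = 0) -> spl k.+1 c lo = 0 ->
  alternates (spl k.+1 c) e lo (t :: ts) ->
  exists2 ts', alternates (spl k (delta c)) e lo ts' & size ts' = (size ts).+2.
Proof.
move=> chi clo [lot et ats].
have [|t1 [lot1 t1t et1]] := @spl_incr R k c e lo t lot.
  by rewrite clo mulr0.
have [|ts' ats' sz] := alternates_diff_from chi _ ats.
  by rewrite mulNr oppr_lt0.
exists (t1 :: ts'); last by rewrite /= sz.
by split=> //; apply: alternates_weaken ats'; apply: ltW.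
Qed.

(** Points at which a step function takes opposite signs lie in different cells,
    all of them among the cells up to q. *)
Lemma alternates_step c q e lo ts : (forall n, q < n -> c n = 0) ->
  e * c (Num.floor lo) <= 0 -> Num.floor lo <= q ->
  alternates (spl 0 c) e lo ts -> (size ts)%:Z <= q - Num.floor lo.
Proof.
move=> cq; elim: ts e lo => [|t ts IH] e lo elo loq /=; first by lia.
move=> [lot et ats].
have le : Num.floor lo <= Num.floor t by apply/le_floor/ltW.
have ne : Num.floor lo != Num.floor t.
  by apply/eqP => E; move: et; rewrite -E ltNge elo.
have tq : Num.floor t <= q.
  by rewrite leNgt; apply/negP => /cq E; move: et; rewrite E mulr0 ltxx.
have := IH (- e) t; rewrite mulNr oppr_le0 => /(_ (ltW et) tq ats); lia.
Qed.

Lemma spl_left0 k c p x : (forall n, n < p -> c n = 0) -> x <= p%:~R ->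
  spl k.+1 c x = 0.
Proof.
move=> cp xp; rewrite -(spl0 k.+1 x) (@spl_local_left _ _ _ (fun=> 0) (p - 1)) //.
- by move=> n np; apply: cp; lia.
- by rewrite subrK.
Qed.

Lemma spl_right0 k c q x : (forall n, q < n -> c n = 0) ->
  (q + 1 + k%:Z)%:~R <= x -> spl k c x = 0.
Proof.
move=> cq xq; rewrite -(spl0 k x) (@spl_local_right _ _ _ (fun=> 0) (q + 1)) //.
by move=> n nq; apply: cq; lia.
Qed.

(** One differentiation gains one alternation and one coefficient, so that the
    bound for step functions carries over to every degree. *)
Lemma alternates_bound k c p q e ts :
  (forall n, n < p -> c n = 0) -> (forall n, q < n -> c n = 0) -> p <= q + 1 ->
  alternates (spl k c) e (p - 1)%:~R ts -> (size ts)%:Z <= q - p + 1.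
Proof.
elim: k c q e ts => [|k IH] c q e ts cp cq pq.
  move=> /(alternates_step cq); rewrite intrKfloor cp ?mulr0 ?lexx; last by lia.
  by move=> /(_ isT); lia.
case: ts => [|t ts] ats /=; first by lia.
have [||ts' ats' sz] := alternates_diff (hi := (q + 1 + k.+1%:Z)%:~R) _ _ ats.
- by move=> x; apply: spl_right0.
- by apply: (@spl_left0 _ _ p) => //; rewrite ler_int; lia.
have := IH (delta c) (q + 1) e ts' _ _ _ ats'; rewrite sz => H.
suff : (size ts).+2%:Z <= q + 1 - p + 1 by lia.
apply: H; last by lia.
- by move=> n np; rewrite /delta !cp ?subrr //; lia.
- by move=> n np; rewrite /delta !cq ?subrr //; lia.
Qed.

(** On a cell, the spline would otherwise vanish on a subinterval, and all of its
    coefficients there would be 0. *)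
Lemma spl_nonzero_between k c p q x y :
  (forall j, p <= j <= q + k.+1%:Z ->
     exists2 n, j - k.+1%:Z <= n <= j & c n != 0) ->
  p%:~R <= x -> x < y -> y <= (q + k.+2%:Z)%:~R ->
  exists t, [/\ x < t, t < y & spl k.+1 c t != 0].
Proof.
move=> win px xy yq; apply: contrapT => nex.
pose j := Num.floor x; pose y' := Num.min y (j + 1)%:~R; pose x' := (x + y') / 2.
have xy' : x < y' by rewrite lt_min xy floorD1_gt.
have y'y : y' <= y by rewrite ge_min lexx.
have [n nj /eqP cn] : exists2 n, j - k.+1%:Z <= n <= j & c n != 0.
  apply: win; rewrite floor_ge_int px /=.
  have : j < q + k.+2%:Z by rewrite floor_lt_int (lt_le_trans xy).
  by lia.
apply: cn; apply: (@spl_unique R k.+1 c j x' y') => //.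
- by have := floor_le x; rewrite -/j /x' => ?; lra.
- by rewrite /x'; lra.
- by rewrite /y' ge_min lexx orbT.
move=> t /andP[xt ty]; apply/eqP/negPn/negP => ct; apply: nex; exists t.
by split=> //; [rewrite /x' in xt; lra | exact: lt_le_trans y'y].
Qed.

Section Gap.
Variables (k : nat) (c : int -> R) (p q : int).
Hypothesis win : forall j, p <= j <= q + k.+1%:Z ->
     exists2 n, j - k.+1%:Z <= n <= j & c n != 0.

(** Between two zeros the spline leaves 0 and comes back. *)
Lemma gap_signs x y :
  p%:~R <= x -> x < y -> y <= (q + k.+2%:Z)%:~R ->
  spl k.+1 c x = 0 -> spl k.+1 c y = 0 ->
  exists e t0 t1, [/\ e != 0, x < t0, t0 < t1 & t1 < y] /\
    0 < e * spl k (delta c) t0 /\ 0 < - e * spl k (delta c) t1.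
Proof.
move=> px xy yq cx cy; have [t [xt ty ct]] := spl_nonzero_between win px xy yq.
have ct2 : 0 < spl k.+1 c t * spl k.+1 c t by rewrite -expr2 exprn_even_gt0.
have [|t0 [xt0 t0t e0]] := @spl_incr R k c (spl k.+1 c t) x t xt.
  by rewrite cx mulr0.
have [|t1 [tt1 t1y e1]] := @spl_incr R k c (- spl k.+1 c t) t y ty.
  by rewrite cy mulr0 mulNr oppr_lt0.
exists (spl k.+1 c t), t0, t1; split=> //; split=> //.
exact: lt_trans tt1.
Qed.

Lemma gap_sign e x y : e != 0 ->
  p%:~R <= x -> x < y -> y <= (q + k.+2%:Z)%:~R ->
  spl k.+1 c x = 0 -> spl k.+1 c y = 0 ->
  exists t, [/\ x < t, t < y & 0 < e * spl k (delta c) t].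
Proof.
move=> e0 px xy yq cx cy; have [t [xt ty ct]] := spl_nonzero_between win px xy yq.
have [et|et] := ltP 0 (e * spl k.+1 c t).
  have [|t0 [xt0 t0t e1]] := @spl_incr R k c e x t xt; first by rewrite cx mulr0.
  by exists t0; split=> //; apply: lt_trans ty.
have {}et : e * spl k.+1 c t < 0 by rewrite lt_neqAle et mulf_neq0.
have [|t1 [tt1 t1y e1]] := @spl_incr R k c e t y ty; first by rewrite cy mulr0.
by exists t1; split=> //; apply: lt_trans tt1.
Qed.

(** As both signs of the derivative occur in every gap between zeros, an
    alternating sequence can be continued with one point in each gap. *)
Lemma alternates_of_zeros e x zs : e != 0 -> p%:~R <= x -> spl k.+1 c x = 0 ->
  path <%R x zs ->
  (forall z, z \in zs -> z <= (q + k.+2%:Z)%:~R /\ spl k.+1 c z = 0) ->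
  exists2 ts, alternates (spl k (delta c)) e x ts & size ts = size zs.
Proof.
elim: zs e x => [|z zs IH] e x e0 px cx; first by exists [::].
move=> /= /andP[xz pz] zsP; have [zq cz] := zsP z (mem_head _ _).
have [t [xt tz et]] := gap_sign e0 px xz zq cx cz.
have [|||ts ats sz] := IH (- e) z _ _ cz pz.
- by rewrite oppr_eq0.
- by rewrite (le_trans px) // ltW.
- by move=> z' z'zs; apply: zsP; rewrite inE z'zs orbT.
exists (t :: ts); last by rewrite /= sz.
by split=> //; apply: alternates_weaken ats; apply: ltW.
Qed.

(** The zeros and the two ends of the support bound one gap more than there are
    zeros.  The first gap yields two alternating points and each other gap one,
    hence two more than zeros, for a derivative with q - p + 2 coefficients. *)
Lemma sorted_zero_count zs : p <= q ->
  (forall n, n < p -> c n = 0) -> (forall n, q < n -> c n = 0) ->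
  sorted <%R zs ->
  (forall z, z \in zs -> [/\ p%:~R < z, z < (q + k.+2%:Z)%:~R &
                            spl k.+1 c z = 0]) ->
  (size zs)%:Z <= q - p.
Proof.
move=> pq cp cq szs zsP; pose hi : R := (q + k.+2%:Z)%:~R.
have cp0 : spl k.+1 c p%:~R = 0 by apply: (@spl_left0 _ _ p).
have chi : spl k.+1 c hi = 0.
  by apply: (@spl_right0 _ _ q) => //; rewrite ler_int; lia.
case Ezs : (rcons zs hi) => [|z1 rest]; first by case: (zs) Ezs.
have shi : path <%R p%:~R (rcons zs hi).
  rewrite rcons_path; apply/andP; split.
    case: (zs) szs zsP => //= z s -> zsP; rewrite andbT.
    by have [] := zsP z (mem_head _ _).
  have := mem_last p%:~R zs; rewrite inE => /predU1P[->|/zsP[_ ? _]] //.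
  by rewrite ltr_int; lia.
have rP z : z \in rcons zs hi -> z <= hi /\ spl k.+1 c z = 0.
  rewrite mem_rcons inE => /predU1P[->|/zsP[_ /ltW ? ?]] //.
rewrite Ezs /= in shi rP; have /andP[pz1 pz] := shi.
have [z1hi cz1] := rP z1 (mem_head _ _).
have [e [t0 [t1 [[e0 pt0 t01 t1z] [et0 et1]]]]] :=
  gap_signs (lexx _) pz1 z1hi cp0 cz1.
have [||ts ats sz] := @alternates_of_zeros e z1 rest e0 _ cz1 pz.
- exact: ltW.
- by move=> z zr; apply: rP; rewrite inE zr orbT.
have szr : (size rest = size zs)%N.
  by apply: succn_inj; rewrite -(size_rcons zs hi) Ezs.
suff : (size [:: t0, t1 & ts])%:Z <= q + 1 - p + 1.
  by rewrite /= sz szr; clear; lia.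
apply: (@alternates_bound k (delta c) p (q + 1) e).
- by move=> n np; rewrite /delta !cp ?subrr //; move: np; clear; lia.
- by move=> n np; rewrite /delta !cq ?subrr //; move: np; clear; lia.
- by move: pq; clear; lia.
split=> //; first by rewrite (le_lt_trans _ pt0) // ler_int; clear; lia.
split=> //; rewrite opprK; apply: alternates_weaken ats.
exact: ltW t1z.
Qed.

Lemma zero_count zs : p <= q ->
  (forall n, n < p -> c n = 0) -> (forall n, q < n -> c n = 0) ->
  uniq zs ->
  (forall z, z \in zs -> [/\ p%:~R < z, z < (q + k.+2%:Z)%:~R &
                            spl k.+1 c z = 0]) ->
  (size zs)%:Z <= q - p.
Proof.
move=> pq cp cq uzs zsP; rewrite -(size_sort <=%R).
apply: sorted_zero_count => //.
  by rewrite sort_lt_sorted.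
by move=> z; rewrite mem_sort; apply: zsP.
Qed.

End Gap.

Lemma cell_of (a b : int) x : a < b -> a%:~R <= x <= b%:~R ->
  exists2 j : int, a <= j < b & j%:~R <= x <= (j + 1)%:~R.
Proof.
move=> ab /andP[ax xb]; have [xb'|bx] := ltP x b%:~R.
  exists (Num.floor x); first by rewrite floor_ge_int ax floor_lt_int.
  by have /andP[-> /ltW ->] := floor_itv x.
exists (b - 1); first by lia.
by rewrite subrK xb (le_trans _ bx) // ler_int; lia.
Qed.

(** Zero counting on a block [a, b] of cells.  Only the coefficients from
    a - k - 1 to b - 1 matter on it, and they may be known to vanish outside
    [l, r].  A zero at the end a is counted only if l has its least possible
    value: if a is itself the left end of the support, then the slack between l
    and the first nonzero coefficient pays for that zero; likewise at b. *)
Lemma zero_count_on k c (a b l r : int) zs : a < b ->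
  (forall j, a <= j < b -> exists2 n, j - k.+1%:Z <= n <= j & c n != 0) ->
  a - k.+1%:Z <= l -> r <= b - 1 ->
  (forall n, a - k.+1%:Z <= n < l -> c n = 0) ->
  (forall n, r < n <= b - 1 -> c n = 0) ->
  uniq zs ->
  (forall z, z \in zs -> a%:~R <= z <= b%:~R /\ spl k.+1 c z = 0) ->
  (a%:~R \in zs -> l = a - k.+1%:Z) -> (b%:~R \in zs -> r = b - 1) ->
  (size zs)%:Z <= r - l.
Proof.
move=> ab win al rb cl cr uzs zsP azs bzs.
pose c' n := if l <= n <= r then c n else 0.
have c'E n : a - k.+1%:Z <= n <= b - 1 -> c' n = c n.
  rewrite /c'; case: ifPn => // nlr nab; have [nl|ln] := ltP n l.
    by rewrite cl //; lia.
  by rewrite cr //; lia.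
have c'0 n : c' n != 0 -> l <= n <= r.
  by rewrite /c'; case: ifP => // _; rewrite eqxx.
have win' j : a <= j < b -> exists2 n, j - k.+1%:Z <= n <= j & c' n != 0.
  by move=> jab; have [n nj cn] := win j jab; exists n => //; rewrite c'E //; lia.
have [|n0 n0a cn0] := win' a; first by lia.
have [|n1 n1b cn1] := win' (b - 1); first by lia.
have [|p cp pmin] := @int_min (fun n => c' n != 0) l n0 _ cn0.
  by move=> n /c'0; lia.
have [|q cq qmax] := @int_max (fun n => c' n != 0) r n0 _ cn0.
  by move=> n /c'0; lia.
have p_n0 := pmin _ cn0; have n1_q := qmax _ cn1; have pq := pmin _ cq.
have pa : p <= a by lia.
have bq : b <= q + k.+2%:Z by lia.
have /andP[lp _] := c'0 _ cp; have /andP[_ qr] := c'0 _ cq.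
have win2 j : p <= j <= q + k.+1%:Z -> exists2 n, j - k.+1%:Z <= n <= j & c' n != 0.
  move=> jpq; have [ja|aj] := ltP j a; first by exists p => //; lia.
  have [jb|bj] := ltP j b; first by apply: win'; rewrite aj jb.
  by exists q => //; lia.
have splE z : a%:~R <= z <= b%:~R -> spl k.+1 c' z = spl k.+1 c z.
  move=> /(cell_of ab)[j jab jz]; apply: spl_local_closed jz => n nj.
  by apply: c'E; lia.
pose zs' := [seq z <- zs | p%:~R < z < (q + k.+2%:Z)%:~R].
have sz' : (size zs')%:Z <= q - p.
  apply: (zero_count win2) => //.
  - by move=> n np; apply/eqP/negPn/negP => /pmin; lia.
  - by move=> n np; apply/eqP/negPn/negP => /qmax; lia.
  - exact: filter_uniq.
  move=> z; rewrite mem_filter => /andP[/andP[-> ->] /zsP[zab cz]].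
  by rewrite splE.
pose ea := (a%:~R \in zs) && (p == a).
pose eb := (b%:~R \in zs) && (q + k.+2%:Z == b).
have : (size zs <= size (zs' ++ nseq ea a%:~R ++ nseq eb b%:~R))%N.
  apply: uniq_leq_size => // z zzs; have [/andP[az zb] cz] := zsP z zzs.
  rewrite !mem_cat !mem_nseq mem_filter zzs andbT.
  have [pz|zp] := ltP p%:~R z; last first.
    have Ea : p = a.
      apply/le_anti/andP; split; first exact: pa.
      by rewrite -(ler_int R) (le_trans az).
    have Ez : z = a%:~R by apply/le_anti; rewrite az -Ea zp.
    by rewrite /ea -Ez zzs Ea !eqxx /= ?orbT.
  have [zq|qz] := ltP z (q + k.+2%:Z)%:~R => //=.
  have Eb : q + k.+2%:Z = b.
    apply/le_anti/andP; split; last exact: bq.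
    by rewrite -(ler_int R) (le_trans qz).
  have Ez : z = b%:~R by apply/le_anti; rewrite zb -Eb qz.
  by rewrite /eb -Ez zzs Eb !eqxx /= ?orbT.
rewrite !size_cat !size_nseq => szs.
have hea : (nat_of_bool ea)%:Z <= p - l.
  rewrite /ea; case: (boolP (_ \in zs)) => [/azs E|_]; last by rewrite subr_ge0.
  case: eqP => [F|_]; last by rewrite subr_ge0.
  by move: E F; clear; rewrite /=; lia.
have heb : (nat_of_bool eb)%:Z <= r - q.
  rewrite /eb; case: (boolP (_ \in zs)) => [/bzs E|_]; last by rewrite subr_ge0.
  case: eqP => [F|_]; last by rewrite subr_ge0.
  by move: E F; clear; rewrite /=; lia.
move: szs sz' hea heb.
move: (size zs) (size zs') (nat_of_bool ea) (nat_of_bool eb); clear; lia.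
Qed.

End ZeroCount.

(** * Splines as series of B-splines *)

Section Link.
Variable R : realType.
Implicit Types (f g : R -> R) (x y t : R) (c : int -> R) (k : nat).
Implicit Types (i j n p q : int).

(** The coefficients of a single B-spline. *)
Definition unit_coef (n : int) : R := (n == 0)%:R.

Lemma spl_sum k N (a : 'I_N -> R) (d : 'I_N -> int -> R) x :
  spl k (fun n => \sum_(i < N) a i * d i n) x = \sum_(i < N) a i * spl k (d i) x.
Proof.
elim: N a d => [|N IH] a d.
  rewrite [RHS]big_ord0 -[RHS](spl0 k x); congr spl.
  by apply/funext => n; rewrite big_ord0.
rewrite big_ord_recl -(IH (fun u => a (lift ord0 u)) (fun u => d (lift ord0 u))).
rewrite -[X in _ + X]mul1r -spl_lin; congr spl.
by apply/funext => n; rewrite big_ord_recl mul1r.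
Qed.

Lemma convolution_unit f x : locbounded f ->
  convolution f \1_(`[0, 1]) x = integ f (x - 1) x.
Proof.
move=> nf; rewrite /convolution /integ Rintegral_itv_bndo_bndc; last first.
  exact: locbounded_integrable.
rewrite [RHS]Rintegral_mkcond; apply: eq_Rintegral => t _.
rewrite patchE indicE.
have -> : (x - t \in `[0, 1]%classic) = (t \in `[x - 1, x]%classic).
  by apply/idP/idP; rewrite !inE /= !in_itv /= => /andP[? ?]; apply/andP; split; lra.
by case: (t \in _); rewrite ?mulr1 ?mulr0.
Qed.

Lemma locbounded_indic_itv (a b : R) : locbounded (\1_(`[a, b]) : R -> R).
Proof.
split; first exact: measurable_indic.
by move=> u v; exists 1 => x _; rewrite indicE; case: (_ \in _);
  rewrite ?normr1 ?normr0.
Qed.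

(** The closed indicator function of [0, 1] and the half-open step function of
    degree 0 differ at 1. *)
Lemma eq_integ_but_one f g (r a b : R) : locbounded f -> locbounded g ->
  (forall t, t != r -> f t = g t) -> integ f a b = integ g a b.
Proof.
move=> nf ng fg; rewrite /integ /Rintegral; congr fine.
apply: ae_eq_integral => //.
- by apply/measurable_EFinP/measurable_funTS; case: nf.
- by apply/measurable_EFinP/measurable_funTS; case: ng.
exists [set r]; split=> //; first exact: lebesgue_measure_set1.
move=> t /= /not_implyP[_ H]; apply: contrapT => tr; apply: H.
by rewrite /= fg //; apply/eqP.
Qed.

Lemma bsplineE k x : bspline k.+1 x = spl k.+1 unit_coef x.
Proof.
elim: k x => [|k IH] x.
  rewrite /bspline /= convolution_unit; last exact: locbounded_indic_itv.
  apply: (@eq_integ_but_one _ _ 1); first exact: locbounded_indic_itv.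
    exact: locbounded_step.
  move=> t t1; rewrite /unit_coef indicE; congr (nat_of_bool _)%:R.
  apply/idP/eqP; rewrite inE /= in_itv /=.
    by move=> /andP[t0 lt1]; apply: floor_def; rewrite t0 lt_neqAle t1 lt1.
  move=> /= ft; have := floor_itv t; rewrite ft add0r => /andP[-> /ltW]; exact.
have bE : bspline k.+1 = spl k.+1 unit_coef by apply/funext.
rewrite [LHS]/bspline iterS -/(bspline k.+1) bE convolution_unit //.
exact: locbounded_spl.
Qed.

(** Near x only the k + 2 terms of one window contribute. *)
Lemma fsum_bspline k c x :
  \sum_(n \in [set: int]) (c n * bspline k.+1 (x - n%:~R)) = spl k.+1 c x.
Proof.
pose F n := c n * bspline k.+1 (x - n%:~R).
pose j : int := Num.floor x - k.+1%:Z.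
pose r := [seq j + u%:Z | u : nat <- iota 0 k.+2].
have ur : uniq r.
  by rewrite map_inj_uniq ?iota_uniq // => a b /addrI [].
have rP n : (n \in r) = (j <= n <= Num.floor x).
  apply/mapP/idP => [[i]|nj].
    by rewrite mem_iota => /andP[_ ik] ->; rewrite /j; lia.
  by exists `|n - j|%N; rewrite ?mem_iota; rewrite /j in nj *; lia.
have FE n : F n = c n * spl k.+1 (fun i => unit_coef (i - n)) x.
  by rewrite /F bsplineE spl_shift.
rewrite -/F (@fsbigE _ _ _ _ [set: int] r) //; last first.
  move=> n _ nr; rewrite -/(F n) FE.
  rewrite (@spl_local _ _ _ (fun=> 0) (Num.floor x)) ?spl0 ?mulr0 ?floor_itv //.
  move=> i ij; rewrite /unit_coef; case: eqP => // E; move: nr.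
  have -> : n = i by move: E; clear; lia.
  by rewrite rP ij.
rewrite (eq_bigl xpredT); last by move=> n; rewrite in_setT.
rewrite big_map -[k.+2]subn0 -/(index_iota 0 k.+2) big_mkord.
under eq_bigr => i _ do rewrite -/(F _) FE.
rewrite -(@spl_sum _ _ (fun i : 'I_k.+2 => c (j + i%:Z))
   (fun (i : 'I_k.+2) n => unit_coef (n - (j + i%:Z)))).
apply: (@spl_local _ _ _ _ (Num.floor x)); last exact: floor_itv.
move=> n nj; have nk : (`|n - j| < k.+2)%N by rewrite /j; lia.
rewrite (bigD1 (Ordinal nk)) //= big1 => [|i /negP ni].
  have -> : j + `|n - j|%N%:Z = n by rewrite /j; lia.
  by rewrite subrr /unit_coef eqxx mulr1 addr0.
rewrite /unit_coef; case: eqP => [E|]; last by rewrite mulr0.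
by case: ni; apply/eqP/val_inj => /=; lia.
Qed.

Lemma spline_spaceE k (g : R -> R) :
  spline_space k.+1 g <-> exists c, g = spl k.+1 c.
Proof.
by split=> -[c ->]; exists c; apply/funext => x; rewrite fsum_bspline.
Qed.

End Link.

(** * Sufficiency of the sampling conditions *)

Section Cardinality.
Variable R : realType.
Implicit Types (E : set R) (s : seq R) (z : int).

Lemma card_geP E z : card_ge E z <->
  exists s, [/\ uniq s, (forall x, x \in s -> E x) & z <= (size s)%:Z].
Proof.
rewrite /card_ge /counting; case: asboolP => [finE|infE].
  rewrite lee_fin -[X in _ <= X]/(Posz _)%:~R ler_int; split=> [zE|[s [us sE zs]]].
    exists (finmap.enum_fset (fset_set E)); split=> //; first exact: finmap.fset_uniq.
    by move=> x; rewrite in_fset_set // inE.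
  apply: le_trans zs _; rewrite lez_nat; apply: uniq_leq_size => // x /sE Ex.
  by rewrite in_fset_set // inE.
split=> _; last by rewrite leey.
have [B BE zB] := infinite_set_fset `|z|%N infE.
exists (finmap.enum_fset B); split; first exact: finmap.fset_uniq.
  by move=> x xB; apply: BE.
by rewrite (@le_trans _ _ `|z|%N%:Z) ?lez_nat //; clear; lia.
Qed.

Lemma card_ltP E z : ~ card_ge E z ->
  exists s, [/\ uniq s, (forall x, E x <-> x \in s) & (size s)%:Z < z].
Proof.
rewrite /card_ge /counting; case: asboolP => [finE|infE]; last by rewrite leey.
rewrite lee_fin -[X in _ <= X]/(Posz _)%:~R ler_int => /negP; rewrite -ltNge => Ez.
exists (finmap.enum_fset (fset_set E)); split=> //; first exact: finmap.fset_uniq.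
by move=> x; rewrite in_fset_set // inE.
Qed.

End Cardinality.

Section Sufficiency.
Variable R : realType.
Implicit Types (f g : R -> R) (x y t : R) (c : int -> R) (k : nat).
Implicit Types (i j n p q : int).

Definition window k c j : Prop := exists2 n, j - k.+1%:Z <= n <= j & c n != 0.

Lemma not_window k c j : ~ window k c j ->
  forall n, j - k.+1%:Z <= n <= j -> c n = 0.
Proof.
by move=> W n nj; apply: contrapT => /eqP cn; apply: W; exists n.
Qed.

Lemma spl_window k c j x : j%:~R <= x <= (j + 1)%:~R -> spl k.+1 c x != 0 ->
  window k c j.
Proof.
move=> jx cx; apply: contrapT => /not_window c0; move: cx.
by rewrite (@spl_local_closed _ _ _ (fun=> 0) j) // spl0 eqxx.
Qed.

(** One formula for the four sampling conditions, according to which ends of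
    [a, b] are ends of [N1, N2]. *)
Lemma sampling_list m (N1 N2 : int) (E : set R) (a b : int) :
  sampling_conditions m N1 N2 E -> E `<=` `[N1%:~R, N2%:~R] ->
  N1 <= a -> a < b -> b <= N2 ->
  exists s, [/\ uniq s,
    forall z, z \in s -> [/\ E z, a%:~R <= z <= b%:~R,
       a%:~R = z -> a = N1 & z = b%:~R -> b = N2] &
    2 * (b - a) - 1 + (if a == N1 then m%:Z else 0)
      + (if b == N2 then m%:Z else 0) <= (size s)%:Z].
Proof.
move=> [E1 E2 E3 E4] EN aN ab bN.
have [Ea|aN1] := eqVneq a N1; have [Eb|bN2] := eqVneq b N2.
- have /card_geP[s [us sE zs]] := E1; exists s; split=> //; last first.
    by move: zs; rewrite /= Ea Eb; clear; lia.
  move=> z /sE Ez; split=> //; rewrite Ea Eb.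
  by have := EN _ Ez; rewrite /= in_itv.
- have /card_geP[s [us sE zs]] := E2 (b - a) ltac:(lia).
  exists s; split=> //; last by move: zs; rewrite /=; clear; lia.
  move=> z /sE[Ez]; rewrite /= in_itv /= -Ea addrC subrK => /andP[az zb].
  by split=> //; [rewrite az ltW | move=> F; move: zb; rewrite F ltxx].
- have /card_geP[s [us sE zs]] := E3 (b - a) ltac:(lia).
  exists s; split=> //; last by move: zs; rewrite /=; clear; lia.
  move=> z /sE[Ez]; rewrite /= in_itv /= -Eb subKr => /andP[az zb].
  by split=> //; [rewrite zb ltW | move=> F; move: az; rewrite F ltxx].
- have /card_geP[s [us sE zs]] := E4 a b aN ab bN.
  exists s; split=> //; last by move: zs; rewrite /=; clear; lia.
  move=> z /sE[Ez]; rewrite /= in_itv /= => /andP[az zb].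
  split=> //; first by rewrite !ltW.
    by move=> F; move: az; rewrite F ltxx.
  by move=> F; move: zb; rewrite F ltxx.
Qed.

Lemma size_filter_or (T : eqType) (P Q : pred T) (s : seq T) :
  (forall z, z \in s -> P z || Q z) ->
  (size s <= size (seq.filter P s) + size (seq.filter Q s))%N.
Proof.
elim: s => //= z s IH sPQ; have /IH {}IH : forall z, z \in s -> P z || Q z.
  by move=> z' z's; apply: sPQ; rewrite inE z's orbT.
by have := sPQ z (mem_head _ _); case: (P z); case: (Q z) => //= _; lia.
Qed.

(** An inner left end of a maximal block is there because one of the two splines
    vanishes on the preceding cell, which costs it k + 1 coefficients. *)
Lemma left_support k (N1 a : int) (cu cv : int -> R) :
  (a <> N1 -> ~ (window k cu (a - 1) /\ window k cv (a - 1))) ->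
  exists lu lv,
    [/\ (a - k.+1%:Z <= lu /\ (a = N1 -> lu = a - k.+1%:Z)),
        (a - k.+1%:Z <= lv /\ (a = N1 -> lv = a - k.+1%:Z)),
        (forall n, a - k.+1%:Z <= n < lu -> cu n = 0),
        (forall n, a - k.+1%:Z <= n < lv -> cv n = 0) &
        lu + lv = 2 * a - k.+1%:Z - (if a == N1 then k.+1%:Z else 0)].
Proof.
have [Ea _|/eqP aN1 /(_ aN1)] := eqVneq a N1.
  exists (a - k.+1%:Z), (a - k.+1%:Z).
  by split=> //; [move=> n | move=> n | ]; lia.
move=> /not_andP[|] /not_window c0.
  exists a, (a - k.+1%:Z); split=> //; try lia.
  by move=> n na; apply: c0; lia.
exists (a - k.+1%:Z), a; split=> //; try lia.
by move=> n na; apply: c0; lia.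
Qed.

Lemma right_support k (N2 b : int) (cu cv : int -> R) :
  (b <> N2 -> ~ (window k cu b /\ window k cv b)) ->
  exists ru rv,
    [/\ (ru <= b - 1 /\ (b = N2 -> ru = b - 1)),
        (rv <= b - 1 /\ (b = N2 -> rv = b - 1)),
        (forall n, ru < n <= b - 1 -> cu n = 0),
        (forall n, rv < n <= b - 1 -> cv n = 0) &
        ru + rv = 2 * (b - 1) - k.+1%:Z + (if b == N2 then k.+1%:Z else 0)].
Proof.
have [Eb _|/eqP bN2 /(_ bN2)] := eqVneq b N2.
  exists (b - 1), (b - 1).
  by split=> //; [move=> n | move=> n | ]; lia.
move=> /not_andP[|] /not_window c0.
  exists (b - 1 - k.+1%:Z), (b - 1); split=> //; try lia.
  by move=> n na; apply: c0; lia.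
exists (b - 1), (b - 1 - k.+1%:Z); split=> //; try lia.
by move=> n na; apply: c0; lia.
Qed.

(** On a maximal block of cells on which neither factor vanishes identically, the
    sample points outnumber the zeros that the two factors may have together. *)
Lemma sampled_product_vanishes k (N1 N2 : int) (E : set R) (cu cv : int -> R) :
  N1 < N2 -> E `<=` `[N1%:~R, N2%:~R] -> sampling_conditions k.+1 N1 N2 E ->
  (forall x, E x -> spl k.+1 cu x * spl k.+1 cv x = 0) ->
  forall x, N1%:~R <= x <= N2%:~R -> spl k.+1 cu x * spl k.+1 cv x = 0.
Proof.
move=> N12 EN Econd Euv x xN; apply: contrapT => /eqP.
rewrite mulf_eq0 => /norP[ux vx].
have [j jN jx] := cell_of N12 xN.
pose good i := [/\ N1 <= i < N2, window k cu i & window k cv i].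
have goodj : good j by split=> //; apply: spl_window jx _.
pose P a := a <= j /\ forall i, a <= i <= j -> good i.
have [||a [aj Pa] amin] := @int_min P N1 j.
- by move=> a [aj /(_ a)[|/andP[]//]]; rewrite lexx.
- by split=> // i ij; have -> : i = j by lia.
pose Q b := j <= b /\ forall i, j <= i <= b -> good i.
have [||b' [jb Qb] bmax] := @int_max Q N2 j.
- by move=> b [jb /(_ b)[|/andP[_ /ltW]//]]; rewrite lexx andbT.
- by split=> // i ij; have -> : i = j by lia.
pose b := b' + 1.
have ab : a < b by rewrite /b; lia.
have [/andP[aN _] _ _] : good a by apply: Pa; rewrite lexx.
have [/andP[_ bN] _ _] : good b' by apply: Qb; rewrite lexx andbT.
have gab i : a <= i < b -> good i.
  move=> iab; have [ij|ji] := leP i j.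
    by apply: Pa; move: iab; rewrite ij andbT => /andP[].
  by apply: Qb; move: iab ji; rewrite /b; clear; lia.
have [|lu [lv [[alu luN] [alv lvN] cul cvl luv]]] := @left_support k N1 a cu cv.
  move=> aN1 [wu wv]; have /amin : P (a - 1); last by lia.
  split; first by lia.
  move=> i ia; have [ai|ia'] := leP a i; first by apply: Pa; lia.
  have -> : i = a - 1 by move: ia ia'; clear; lia.
  by split=> //; lia.
have [|ru [rv [[rub ruN] [rvb rvN] cur cvr ruv]]] := @right_support k N2 b cu cv.
  move=> bN2 [wu wv]; have /bmax : Q b; last by rewrite /b; clear; lia.
  split; first by lia.
  move=> i ib; have [ai|ia'] := leP i b'; first by apply: Qb; lia.
  have -> : i = b by move: ib ia'; rewrite /b; clear; lia.
  by split=> //; lia.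
have bN' : b <= N2 by rewrite /b; move: bN; clear; lia.
have [s [us sE]] := sampling_list Econd EN aN ab bN'.
have su : (size [seq z <- s | spl k.+1 cu z == 0])%:Z <= ru - lu.
  apply: (@zero_count_on _ k cu a b) => //.
  - by move=> i /gab[].
  - exact: filter_uniq.
  - by move=> z; rewrite mem_filter => /andP[/eqP cz /sE[_ ? _ _]].
  - by rewrite mem_filter => /andP[_ /sE[_ _ /(_ erefl) Ea _]]; apply: luN.
  - by rewrite mem_filter => /andP[_ /sE[_ _ _ /(_ erefl) Eb]]; apply: ruN.
have sv : (size [seq z <- s | spl k.+1 cv z == 0])%:Z <= rv - lv.
  apply: (@zero_count_on _ k cv a b) => //.
  - by move=> i /gab[].
  - exact: filter_uniq.
  - by move=> z; rewrite mem_filter => /andP[/eqP cz /sE[_ ? _ _]].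
  - by rewrite mem_filter => /andP[_ /sE[_ _ /(_ erefl) Ea _]]; apply: lvN.
  - by rewrite mem_filter => /andP[_ /sE[_ _ _ /(_ erefl) Eb]]; apply: rvN.
have ssum : (size s)%:Z <= (size [seq z <- s | spl k.+1 cu z == 0])%:Z +
    (size [seq z <- s | spl k.+1 cv z == 0])%:Z.
  rewrite -PoszD lez_nat; apply: size_filter_or => z /sE[Ez _ _ _].
  by rewrite -mulf_eq0 Euv.
move: ssum su sv luv ruv.
move: (if a == N1 then _ else _) (if b == N2 then _ else _) => dl dr.
move: (size s) (size (seq.filter _ _)) (size (seq.filter _ _)).
clear; lia.
Qed.

Lemma sampled_abs_eq k (N1 N2 : int) (E : set R) (c1 c2 : int -> R) :
  N1 < N2 -> E `<=` `[N1%:~R, N2%:~R] -> sampling_conditions k.+1 N1 N2 E ->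
  (forall x, E x -> `|spl k.+1 c1 x| = `|spl k.+1 c2 x|) ->
  forall x, N1%:~R <= x <= N2%:~R ->
    (spl k.+1 c1 x + spl k.+1 c2 x) * (spl k.+1 c1 x - spl k.+1 c2 x) = 0.
Proof.
move=> N12 EN Econd E12 x xN.
have sE a y : spl k.+1 (fun n => 1 * c1 n + a * c2 n) y =
    spl k.+1 c1 y + a * spl k.+1 c2 y by rewrite spl_lin mul1r.
have := @sampled_product_vanishes k N1 N2 E (fun n => 1 * c1 n + 1 * c2 n)
  (fun n => 1 * c1 n + (-1) * c2 n) N12 EN Econd _ x xN.
rewrite !sE mul1r mulN1r; apply=> y /E12 /eqP.
rewrite eqr_norm2 !sE mul1r mulN1r -[_ == - _]addr_eq0 => /orP[] /eqP ->.
  by rewrite subrr mulr0.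
by rewrite mul0r.
Qed.

End Sufficiency.

(** * Nonseparable splines with prescribed zeros *)

Section Gapless.
Variable R : realType.
Implicit Types (f g : R -> R) (x y t : R) (c : int -> R) (k m : nat).
Implicit Types (i j n p q s : int).

(** The coefficients at p and q are nonzero and no m consecutive coefficients
    between them vanish; the formula looks ahead from each index, which suits
    inductions over the indices. *)
Definition gapless m c p q : Prop :=
  [/\ p <= q, c p != 0, c q != 0 &
    forall n, p <= n < q ->
      exists n', [/\ n < n' <= n + m%:Z, n' <= q & c n' != 0]].

Lemma coef_eq0 k (N1 N2 : int) c : N1 < N2 ->
  (forall x, N1%:~R <= x <= N2%:~R -> spl k.+1 c x = 0) ->
  forall n, N1 - k.+1%:Z <= n <= N2 - 1 -> c n = 0.
Proof.
move=> N12 c0 n nN; pose j := Num.max N1 n.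
have [jN jn] : N1 <= j <= N2 - 1 /\ j - k.+1%:Z <= n <= j.
  by rewrite /j maxEge; case: ifP => h; split; lia.
have jR : N1%:~R <= j%:~R :> R by rewrite ler_int; case/andP: jN.
have j1R : (j + 1)%:~R <= N2%:~R :> R by rewrite ler_int; move: jN; clear; lia.
apply: (@spl_unique R k.+1 c j j%:~R (j + 1)%:~R) jn => //.
  by rewrite ltr_int; clear; lia.
move=> t /andP[jt tj]; apply: c0.
by rewrite (le_trans jR jt) (le_trans (ltW tj) j1R).
Qed.

(** If the first factor is nonzero at some point of the cell, it remains so on an
    interval to its right, where the second factor must vanish. *)
Lemma product_window k c1 c2 j :
  (forall x, j%:~R <= x < (j + 1)%:~R -> spl k.+1 c1 x * spl k.+1 c2 x = 0) ->
  (forall n, j - k.+1%:Z <= n <= j -> c1 n = 0) \/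
  (forall n, j - k.+1%:Z <= n <= j -> c2 n = 0).
Proof.
move=> c12; have jj : j%:~R < (j + 1)%:~R :> R by rewrite ltr_int; clear; lia.
case: (pselect (exists2 x, j%:~R <= x < (j + 1)%:~R & spl k.+1 c1 x != 0)); last first.
  move=> nex; left; apply: spl_unique jj (lexx _) _ => // t tj.
  by apply/eqP/negPn/negP => ct; apply: nex; exists t.
move=> [x /andP[jx xj] cx]; right.
have [|d d0 hd] := @right_cont_spl R k.+1 c1 x `|spl k.+1 c1 x|.
  by rewrite normr_gt0.
pose y := Num.min (j + 1)%:~R (x + d).
apply: (@spl_unique R k.+1 c2 j x y) => //.
- by rewrite lt_min xj ltrDl.
- by rewrite ge_min lexx.
move=> t /andP[xt ty].
have := c12 t; rewrite (le_trans jx xt) (lt_le_trans ty) ?ge_min ?lexx //.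
move=> /(_ isT) /eqP; rewrite mulf_eq0 => /orP[/eqP ct|/eqP //].
have := hd t; rewrite xt (lt_le_trans ty) ?ge_min ?lexx ?orbT // ct sub0r normrN.
by rewrite ltxx => /(_ isT).
Qed.

(** Nonzero coefficients of c1 and of c2 are more than m apart, so the index set
    of nonzero coefficients of c cannot pass from the one to the other.  The
    first nonzero coefficient of c2 would have a nonzero coefficient of c, hence
    of c1, among the m preceding it. *)
Lemma gapless_one_side m c c1 c2 (A B p q : int) :
  A <= p -> q <= B ->
  (forall n, A <= n <= B -> c n = c1 n + c2 n) ->
  (forall n n', A <= n <= B -> A <= n' <= B -> n' - m%:Z <= n <= n' ->
     c1 n = 0 \/ c2 n' = 0) ->
  gapless m c p q ->
  (forall n, A <= n <= B -> c n != 0 -> p <= n <= q) ->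
  c1 p != 0 -> forall n, A <= n <= B -> c2 n = 0.
Proof.
move=> Ap qB cE c12 [pq cp cq gap] cpq c1p n0 n0AB.
apply/eqP/negPn/negP => c2n0.
pose P n := A <= n <= B /\ c2 n != 0.
have [||n [nAB c2n] nmin] := @int_min P A n0.
- by move=> n [/andP[]].
- by [].
have c1n : c1 n = 0.
  have [//|//|c2n'] := c12 n n nAB nAB; first by rewrite lexx andbT; clear; lia.
  by rewrite c2n' eqxx in c2n.
have /andP[pn nq] : p <= n <= q by apply: cpq => //; rewrite cE // c1n add0r.
have pnn : p < n.
  by rewrite lt_neqAle pn andbT; apply/eqP => E; move: c1p; rewrite E c1n eqxx.
have [n' [pn' nn' cn']] : exists n', [/\ p <= n', n - m%:Z <= n' <= n - 1 & c n' != 0].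
  have [h|h] := ltP (n - m%:Z - 1) p.
    by exists p; split=> //; move: h pnn; clear; lia.
  have [|n' [h1 h2 h3]] := gap (n - m%:Z - 1).
    by move: h nq; clear; lia.
  by exists n'; split=> //; move: h h1 pnn; clear; lia.
have n'AB : A <= n' <= B by move: Ap qB pn' nn' nq; clear; lia.
have c2n' : c2 n' = 0.
  apply/eqP/negPn/negP => c2n'; have := nmin n' (conj n'AB c2n').
  by move: nn'; clear; lia.
have [|c1n'|c2n''] := c12 n' n n'AB nAB.
- by move: nn'; clear; lia.
- by move: cn'; rewrite cE // c1n' c2n' addr0 eqxx.
- by rewrite c2n'' eqxx in c2n.
Qed.

(** In a decomposition f1 + f2 with f1 f2 = 0, one of f1, f2 vanishes on each
    cell, by [product_window].  Hence coefficients of f1 and f2 with indices at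
    most k + 1 apart are not both nonzero, and [gapless_one_side] applies. *)
Lemma gapless_nonseparable k (N1 N2 : int) c p q : N1 < N2 ->
  N1 - k.+1%:Z <= p -> q <= N2 - 1 -> gapless k.+1 c p q ->
  (forall n, N1 - k.+1%:Z <= n <= N2 - 1 -> c n != 0 -> p <= n <= q) ->
  ~ separable (@spline_space_on R k.+1 N1 N2)
      (fun x => spl k.+1 c x * \1_(`[N1%:~R, N2%:~R]) x).
Proof.
move=> N12 Np qN gap csupp [f1 [f2 [[H1 nz1] [H2 nz2] fE f12]]].
have [g1 /spline_spaceE[c1 ->] E1] := H1; have [g2 /spline_spaceE[c2 ->] E2] := H2.
pose A := N1 - k.+1%:Z; pose B := N2 - 1.
have ind1 x : N1%:~R <= x <= N2%:~R -> \1_(`[N1%:~R, N2%:~R]) x = 1 :> R.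
  by move=> xN; rewrite indicE mem_set //= in_itv.
have zero_of (f : R -> R) d : f = (fun x => spl k.+1 d x * \1_(`[N1%:~R, N2%:~R]) x) ->
    (forall n, A <= n <= B -> d n = 0) -> f = cst 0.
  move=> -> d0; apply/funext => x; rewrite indicE.
  case: (boolP (x \in _)) => [xI|_]; last by rewrite mulr0.
  have xN : N1%:~R <= x <= N2%:~R by move: xI; rewrite inE /= in_itv.
  have [j jN jx] := cell_of N12 xN.
  rewrite (@spl_local_closed _ _ _ (fun=> 0) j) ?spl0 ?mul0r // => n nj.
  by apply: d0; rewrite /A /B; move: jN nj; clear; lia.
have cE n : A <= n <= B -> c n = c1 n + c2 n.
  move=> nAB; pose d := fun n => 1 * c n + (-1) * (1 * c1 n + 1 * c2 n).
  have /eqP : d n = 0.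
    apply: (@coef_eq0 k N1 N2) => // x xN; rewrite !spl_lin.
    have := congr1 (fun f => f x) fE; rewrite /= E1 E2 ind1 // !mulr1.
    by rewrite -/(spl k.+1 c x) -/(spl k.+1 c1 x) -/(spl k.+1 c2 x) => ->; lra.
  by rewrite /d !mul1r mulN1r subr_eq0 => /eqP.
have win j : N1 <= j < N2 -> (forall n, j - k.+1%:Z <= n <= j -> c1 n = 0) \/
    (forall n, j - k.+1%:Z <= n <= j -> c2 n = 0).
  move=> /andP[jN1 jN2]; apply: product_window => x /andP[jx xj].
  have xN : N1%:~R <= x <= N2%:~R.
    rewrite (le_trans _ jx) ?ler_int // (le_trans (ltW xj)) // ler_int.
    by move: jN2; clear; lia.
  by have := f12 x; rewrite E1 E2 /= ind1 // !mulr1.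
have c12 d1 d2 : (forall j, N1 <= j < N2 ->
    (forall n, j - k.+1%:Z <= n <= j -> d1 n = 0) \/
    (forall n, j - k.+1%:Z <= n <= j -> d2 n = 0)) -> forall n n',
    A <= n <= B -> A <= n' <= B -> n' - k.+1%:Z <= n <= n' ->
    d1 n = 0 \/ d2 n' = 0 :> R.
  move=> dw n n' nAB n'AB nn'; pose j := Num.max N1 n'.
  have jP : [/\ N1 <= j < N2, j - k.+1%:Z <= n <= j & j - k.+1%:Z <= n' <= j].
    rewrite /j maxEge; move: nAB n'AB nn'; rewrite /A /B.
    by case: ifP => h; split; lia.
  have [jN jn jn'] := jP; have [d0|d0] := dw j jN; first by left; apply: d0.
  by right; apply: d0.
have [_ cp _ _] := gap.
have pAB : A <= p <= B.
  by rewrite Np /=; move: gap => [pq _ _ _]; apply: le_trans qN.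
have [c1p|c1p] := eqVneq (c1 p) 0.
  apply: nz1; apply: zero_of E1 _.
  apply: (@gapless_one_side k.+1 c c2 c1 A B p q) => //.
  - by move=> n nAB; rewrite addrC cE.
  - by apply: c12 => j /win [|]; [right | left].
  - by move: cp; rewrite cE // c1p add0r.
apply: nz2; apply: zero_of E2 _.
apply: (@gapless_one_side k.+1 c c1 c2 A B p q) => //.
exact: c12.
Qed.

Lemma gapless_window m c p q : gapless m c p q ->
  forall j, p <= j <= q + m%:Z -> exists2 n, j - m%:Z <= n <= j & (c n != 0) && (n <= q).
Proof.
move=> [pq cp cq gap] j jpq; have [jp|pj] := leP (j - m%:Z) p.
  by exists p; rewrite ?cp //; move: jp jpq; clear; lia.
have [|n [nj nq cn]] := gap (j - m%:Z - 1).
  by move: pj jpq; clear; lia.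
by exists n; rewrite ?cn ?nq //; move: nj; clear; lia.
Qed.

(** Let [p, q] be the first piece of the support of c that is not interrupted by
    k + 1 consecutive zeros.  On its B-spline support the spline is given by this
    piece alone, so it has at most q - p zeros there; but if [p, q] were not all
    of [s, s + l], then q - p + 1 of the points x would lie there. *)
Lemma interlaced_gapless k c s (l : nat) (x : nat -> R) :
  (forall n, c n != 0 -> s <= n <= s + l%:Z) -> (exists n, c n != 0) ->
  (forall u, (u < l)%N -> (s + u.+1%:Z)%:~R < x u < (s + u.+1%:Z + k.+1%:Z)%:~R) ->
  (forall u v, (u < l)%N -> (v < l)%N -> x u = x v -> u = v) ->
  (forall u, (u < l)%N -> spl k.+1 c (x u) = 0) ->
  gapless k.+1 c s (s + l%:Z).
Proof.
move=> csupp [n0 cn0] xP xinj xc.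
have [||p cp pmin] := @int_min (fun n => c n != 0) s n0.
- by move=> n /csupp /andP[].
- by [].
pose P q := p <= q /\ forall n, q < n <= q + k.+1%:Z -> c n = 0.
have [||q [pq cq0] qmin] := @int_min P p (s + l%:Z).
- by move=> q [].
- split; first by case/andP: (csupp p cp).
  move=> n nq; apply/eqP/negPn/negP => /csupp; move: nq; clear; lia.
have gap : gapless k.+1 c p q.
  have gap n : p <= n < q ->
      exists n', [/\ n < n' <= n + k.+1%:Z, n' <= q & c n' != 0].
    move=> /andP[pn nq]; apply: contrapT => nex.
    suff /qmin : P n by rewrite leNgt nq.
    split=> // n' n'n; apply/eqP/negPn/negP => cn'; apply: nex.
    exists n'; split=> //; rewrite leNgt; apply/negP => qn'.
    by move: cn'; rewrite cq0 ?eqxx // qn'; move: n'n nq; clear; lia.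
  split=> //; have [Epq|npq] := eqVneq p q; first by rewrite -Epq.
  have [|n' [h1 h2 cn']] := gap (q - 1).
    by move: pq npq; clear; lia.
  by have -> : q = n' by move: h1 h2; clear; lia.
have /andP[sp ps] := csupp p cp; have [_ _ cq _] := gap.
have /andP[sq qs] := csupp q cq.
have [/andP[/eqP Ep /eqP Eq]|npq] := boolP ((p == s) && (q == s + l%:Z)).
  by rewrite -Eq -[X in gapless _ _ X _]Ep.
exfalso.
pose w n := if n <= q then c n else 0.
have w_win j : p <= j <= q + k.+1%:Z ->
    exists2 n, j - k.+1%:Z <= n <= j & w n != 0.
  move=> /(gapless_window gap)[n nj /andP[cn nq]].
  by exists n; rewrite // /w nq.
(* These q - p + 1 points lie between p and q + k + 2: the knots below them run
   from p to q, or from p + 1 to q + 1 when p = s, as no point goes with s. *)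
pose u0 := (if p == s then 0%N else absz (p - s - 1)%R).
have uP (u : nat) : u \in iota u0 (absz (q - p + 1)%R) ->
    [/\ (u < l)%N, p <= s + u.+1%:Z & s + u.+1%:Z <= q + 1].
  rewrite mem_iota /u0; move: npq sp sq ps qs pq; clear.
  by case: eqP => /= h; [case: eqP => //= h'|]; split; lia.
have wE y : y <= (q + k.+1%:Z + 1)%:~R -> spl k.+1 w y = spl k.+1 c y.
  apply: spl_local_left => n nq; rewrite /w; case: leP => // qn.
  by rewrite cq0 // qn.
have := @zero_count R k w p q w_win [seq x u | u <- iota u0 (absz (q - p + 1)%R)] pq.
rewrite size_map size_iota => H.
suff : ((absz (q - p + 1)%R))%:Z <= q - p by move: pq; clear; lia.
apply: H.
- move=> n np; rewrite /w; case: ifP => // _.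
  by apply/eqP/negPn/negP => /pmin; rewrite leNgt np.
- by move=> n qn; rewrite /w leNgt qn.
- rewrite map_inj_in_uniq ?iota_uniq // => u v /uP[ul _ _] /uP[vl _ _].
  exact: xinj.
move=> z /mapP[u /uP[ul pu uq] ->]; have /andP[x1 x2] := xP u ul.
have xq : x u < (q + k.+2%:Z)%:~R.
  by apply: (lt_le_trans x2); rewrite ler_int; move: uq; clear; lia.
split=> //; first by apply: le_lt_trans x1; rewrite ler_int.
rewrite wE ?xc //; apply: (le_trans (ltW xq)).
by rewrite ler_int; clear; lia.
Qed.

(** There are l + 1 unknown coefficients for l linear equations. *)
Lemma exists_vanishing k s (l : nat) (x : nat -> R) :
  exists c, [/\ forall n, c n != 0 -> s <= n <= s + l%:Z, exists n, c n != 0 &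
    forall u, (u < l)%N -> spl k.+1 c (x u) = 0].
Proof.
pose d (a : 'I_l.+1) n : R := unit_coef R (n - (s + (a : nat)%:Z)).
pose M : 'M[R]_(l.+1, l) := \matrix_(a, b) spl k.+1 (d a) (x b).
have [v v0 vM] : exists2 v : 'rV[R]_l.+1, v != 0 & v *m M = 0.
  have kM : kermx M != 0.
    by rewrite -mxrank_eq0 mxrank_ker subn_eq0 -ltnNge ltnS rank_leq_col.
  by have /rowV0Pn[v /sub_kermxP vM v0] := kM; exists v.
exists (fun n => \sum_(a < l.+1) v 0 a * d a n); split.
- move=> n; apply: contraR => nl; rewrite big1 // => a _.
  rewrite /d /unit_coef; case: eqP => [E|]; last by rewrite mulr0.
  by move: nl (ltn_ord a) E; clear; lia.
- have [a va] : exists a, v 0 a != 0.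
    by apply/rV0Pn.
  exists (s + (a : nat)%:Z); rewrite (bigD1 a) //= big1 => [|b /negP ba].
    by rewrite /d subrr /unit_coef eqxx mulr1 addr0.
  rewrite /d /unit_coef; case: eqP => [E|]; last by rewrite mulr0.
  by case: ba; apply/eqP/val_inj => /=; move: E; clear; lia.
move=> u ul; rewrite spl_sum.
have := congr1 (fun A : 'rV[R]_l => A 0 (Ordinal ul)) vM.
rewrite [in LHS]mxE [in RHS]mxE => E.
rewrite -[RHS]E.
by apply: eq_bigr => a _; rewrite mxE.
Qed.

Lemma interlaced_null_spline k s (l : nat) (x : nat -> R) :
  (forall u, (u < l)%N -> (s + u.+1%:Z)%:~R < x u < (s + u.+1%:Z + k.+1%:Z)%:~R) ->
  (forall u v, (u < l)%N -> (v < l)%N -> x u = x v -> u = v) ->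
  exists c, [/\ gapless k.+1 c s (s + l%:Z),
    forall n, c n != 0 -> s <= n <= s + l%:Z &
    forall u, (u < l)%N -> spl k.+1 c (x u) = 0].
Proof.
move=> xP xinj; have [c [csupp cn0 cx]] := exists_vanishing k s l x.
by exists c; split=> //; apply: interlaced_gapless xP xinj cx.
Qed.

Lemma fresh_point (a b : R) (r : seq R) : a < b ->
  exists x, a < x < b /\ x \notin r.
Proof.
elim: r a b => [|y r IH] a b ab.
  by exists ((a + b) / 2); split=> //; apply/andP; split; lra.
have [/andP[ay yb]|yab] := boolP (a < y < b).
  have [x [/andP[ax xy] xr]] := IH a y ay; exists x.
  by rewrite ax (lt_trans xy) // inE negb_or xr (lt_eqF xy).
have [x [xab xr]] := IH a b ab; exists x; split=> //.
by rewrite inE negb_or xr andbT; apply: contraNneq yab => <-.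
Qed.

(** Each index with a nonzero coefficient excludes at most one value of e. *)
Lemma generic_combination (cu cv : int -> R) s (l : nat) :
  exists2 e : R, e != 0 & forall n, s <= n <= s + l%:Z ->
    (cu n != 0) || (cv n != 0) -> cu n + e * cv n != 0.
Proof.
have [e [/andP[e0 _] eP]] :=
  @fresh_point 0 1 [seq - cu (s + u%:Z) / cv (s + u%:Z) | u : nat <- iota 0 l.+1] ltr01.
exists e; first by rewrite gt_eqF.
move=> n nsl; have [->|cvn] := eqVneq (cv n) 0.
  by rewrite mulr0 addr0 orbF.
move=> _; apply: contra eP => /eqP H; apply/mapP; exists `|n - s|%N.
  by rewrite mem_iota; move: nsl; clear; lia.
have -> : s + `|n - s|%N%:Z = n by move: nsl; clear; lia.
apply: (mulIf cvn); rewrite divfK //; apply/eqP.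
by rewrite -addr_eq0 addrC H.
Qed.

(** The two blocks of coefficients overlap or are at most m apart. *)
Lemma gapless_union m (cu cv cw : int -> R) (su eu sv ev : int) :
  (forall n, cu n != 0 -> su <= n <= eu -> cw n != 0) ->
  (forall n, cv n != 0 -> sv <= n <= ev -> cw n != 0) ->
  su <= sv -> sv <= eu + m%:Z ->
  gapless m cu su eu -> gapless m cv sv ev -> gapless m cw su (Num.max eu ev).
Proof.
move=> uw vw suv svu [sue cus cue gu] [sve cvs cve gv].
have Mu : eu <= Num.max eu ev by rewrite le_max lexx.
have Mv : ev <= Num.max eu ev by rewrite le_max lexx orbT.
split.
- exact: le_trans Mu.
- by apply: uw; rewrite ?lexx.
- by rewrite maxEge; case: ifP => _; [apply: uw | apply: vw]; rewrite ?lexx ?andbT.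
move=> n /andP[sn nM]; have [neu|eun] := ltP n eu.
  have [|n' [h1 h2 h3]] := gu n; first by rewrite sn neu.
  exists n'; split=> //; first exact: le_trans Mu.
  by apply: uw => //; rewrite h2 andbT; move: h1 sn; clear; lia.
have nev : n < ev by move: nM; rewrite lt_max ltNge eun.
have [svn|nsv] := leP sv n.
  have [|n' [h1 h2 h3]] := gv n; first by rewrite svn nev.
  exists n'; split=> //; first exact: le_trans Mv.
  by apply: vw => //; rewrite h2 andbT; move: h1 svn; clear; lia.
exists sv; split.
- by move: nsv svu eun; clear; lia.
- exact: le_trans Mv.
- by apply: vw; rewrite ?lexx.
Qed.

(** Everything needed to refute phaseless sampling: blocks of coefficients for u
    and v, and interlacing points for each, such that at every point of E one of
    the two splines vanishes.  The functions u + e v and u - e v then have the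
    same unsigned samples, and differ because neither u nor v is 0 on [N1, N2]. *)
Lemma interlaced_not_phaseless k (N1 N2 : int) (E : set R)
    (su sv : int) (lu lv : nat) (xu xv : nat -> R) :
  N1 < N2 -> N1 - k.+1%:Z <= su -> su <= sv -> sv <= su + lu%:Z + k.+1%:Z ->
  su + lu%:Z <= N2 - 1 -> sv + lv%:Z <= N2 - 1 ->
  (forall u, (u < lu)%N -> (su + u.+1%:Z)%:~R < xu u < (su + u.+1%:Z + k.+1%:Z)%:~R) ->
  (forall u v, (u < lu)%N -> (v < lu)%N -> xu u = xu v -> u = v) ->
  (forall u, (u < lv)%N -> (sv + u.+1%:Z)%:~R < xv u < (sv + u.+1%:Z + k.+1%:Z)%:~R) ->
  (forall u v, (u < lv)%N -> (v < lv)%N -> xv u = xv v -> u = v) ->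
  (forall x, E x -> x <= sv%:~R \/ (su + lu%:Z + k.+2%:Z)%:~R <= x \/
     (sv + lv%:Z + k.+2%:Z)%:~R <= x \/
     (exists2 u, (u < lu)%N & x = xu u) \/ (exists2 u, (u < lv)%N & x = xv u)) ->
  ~ phaseless_sampling (@spline_space_on R k.+1 N1 N2) E.
Proof.
move=> N12 Nsu suv svu uN vN xuP xui xvP xvi cover phaseless.
have [cu [gu su_supp u0]] := interlaced_null_spline xuP xui.
have [cv [gv sv_supp v0]] := interlaced_null_spline xvP xvi.
have uv0 x : E x -> spl k.+1 cu x * spl k.+1 cv x = 0.
  have cuR n : su + lu%:Z < n -> cu n = 0.
    by move=> h; apply/eqP/negPn/negP => /su_supp; rewrite [n <= _]leNgt h andbF.
  have cvR n : sv + lv%:Z < n -> cv n = 0.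
    by move=> h; apply/eqP/negPn/negP => /sv_supp; rewrite [n <= _]leNgt h andbF.
  have cvL n : n < sv -> cv n = 0.
    by move=> h; apply/eqP/negPn/negP => /sv_supp; rewrite leNgt h.
  move=> /cover[h|[h|[h|[[u ul ->]|[u ul ->]]]]].
  - by rewrite (@spl_left0 R k cv sv x cvL h) mulr0.
  - rewrite (@spl_right0 _ _ _ _ _ cuR) ?mul0r //.
    by apply: le_trans h; rewrite ler_int; clear; lia.
  - rewrite (@spl_right0 _ _ _ _ _ cvR) ?mulr0 //.
    by apply: le_trans h; rewrite ler_int; clear; lia.
  - by rewrite u0 // mul0r.
  - by rewrite v0 // mulr0.
have [e e0 eP] := generic_combination cu cv (N1 - k.+1%:Z)
  (absz (N2 - 1 - (N1 - k.+1%:Z))%R).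
have {}eP n : N1 - k.+1%:Z <= n <= N2 - 1 ->
    (cu n != 0) || (cv n != 0) -> cu n + e * cv n != 0.
  by move=> nN; apply: eP; move: nN N12; clear; lia.
pose cw n := 1 * cu n + e * cv n; pose cz n := 1 * cu n + (- e) * cv n.
pose I := \1_(`[N1%:~R, N2%:~R]) : R -> R.
have gw : gapless k.+1 cw su (Num.max (su + lu%:Z) (sv + lv%:Z)).
  apply: (gapless_union _ _ suv svu gu gv) => n cn nn; rewrite /cw mul1r eP ?cn ?orbT //.
    by move: nn Nsu uN; clear; lia.
  by move: nn Nsu suv vN; clear; lia.
have Iin x : N1%:~R <= x <= N2%:~R -> I x = 1.
  by move=> xN; rewrite /I indicE mem_set //= in_itv.
have inH c : spline_space_on k.+1 N1 N2 (fun x => spl k.+1 c x * I x).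
  by exists (spl k.+1 c) => //; apply/spline_spaceE; exists c.
have [||E1|E1] := phaseless _ _ (inH cw) _ (inH cz).
- apply: gapless_nonseparable gw _ => //.
    by rewrite ge_max uN vN.
  move=> n _; rewrite /cw le_max; have [->|/su_supp/andP[-> ->] //] := eqVneq (cu n) 0.
  have [->|/sv_supp/andP[h ->]] := eqVneq (cv n) 0.
    by rewrite !mulr0 addr0 eqxx.
  by rewrite orbT (le_trans suv h).
- move=> x /uv0 /eqP; rewrite /cw /cz !normrM !spl_lin mulf_eq0.
  by case/orP => /eqP ->; rewrite ?mulr0 ?add0r ?addr0 // mulNr normrN.
- have [_ cvs _ _] := gv; move: cvs; rewrite (@coef_eq0 k N1 N2 cv) ?eqxx //.
    move=> x xN.
    have h : spl k.+1 cz x * I x = (spl k.+1 cw x * I x) := congr1 (fun f => f x) E1.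
    rewrite (Iin _ xN) !mulr1 /cz /cw !spl_lin in h.
    have : e * spl k.+1 cv x = 0 by move: h; clear; lra.
    by move/eqP; rewrite mulf_eq0 (negPf e0) => /eqP.
  by move: Nsu suv vN; clear; lia.
- have [_ cus _ _] := gu; move: cus; rewrite (@coef_eq0 k N1 N2 cu) ?eqxx //.
    move=> x xN.
    have h : spl k.+1 cz x * I x = - (spl k.+1 cw x * I x) := congr1 (fun f => f x) E1.
    rewrite (Iin _ xN) !mulr1 /cz /cw !spl_lin in h.
    by move: h; clear; lra.
  by move: Nsu suv uN; clear; lia.
Qed.

End Gapless.

(** * Necessity of the sampling conditions *)

Section Necessity.
Variable R : realType.
Implicit Types (x y t : R) (ys : seq R) (A E : set R).

(** Failing conditions give an upper bound for the number of points; extra points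
    bring it to the exact value that the index arithmetic wants. *)
Lemma sorted_padding (a b : R) A (s : seq R) (M : nat) : a < b ->
  (forall x, a < x < b -> A x) -> uniq s -> (forall x, x \in s -> A x) ->
  (size s <= M)%N ->
  exists ys, [/\ sorted <%R ys, size ys = M, {subset s <= ys} &
    forall x, x \in ys -> A x].
Proof.
move=> ab abA us sA sM.
suff [r [ur szr sr rA]] : exists r, [/\ uniq r, size r = M, {subset s <= r} &
    forall x, x \in r -> A x].
  exists (sort <=%R r); split.
  - by rewrite sort_lt_sorted.
  - by rewrite size_sort.
  - by move=> x /sr; rewrite mem_sort.
  - by move=> x; rewrite mem_sort; apply: rA.
rewrite -(subnKC sM); elim: (M - size s)%N => [|d [r [ur szr sr rA]]].
  by exists s; split=> //; rewrite addn0.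
have [x [xab xr]] := fresh_point r ab; exists (x :: r); split=> /=.
- by rewrite xr ur.
- by rewrite szr addnS.
- by move=> y /sr yr; rewrite inE yr orbT.
- by move=> y; rewrite inE => /predU1P[->|/rA//]; apply: abA.
Qed.

(** With more than i points of the list below t, the point of index i is one of
    them. *)
Lemma nth_lt_card ys A t (z : int) (i : nat) : sorted <%R ys ->
  (forall x, A x -> x \in ys) -> (forall x, A x -> x < t) ->
  card_ge A z -> i.+1%:Z <= z -> nth 0 ys i < t.
Proof.
move=> sys Ays At /card_geP[r [ur rA zr]] iz; rewrite ltNge; apply/negP => ti.
have ir : (i < size r)%N by move: zr iz; clear; lia.
have : (size r <= size (take i ys))%N.
  apply: uniq_leq_size => // x /rA Ax.
  have xys := Ays _ Ax; rewrite -(nth_index 0 xys).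
  have xi : (index x ys < i)%N.
    rewrite ltnNge; apply/negP => ix.
    have := At _ Ax; rewrite ltNge -{1}(nth_index 0 xys) (le_trans ti) //.
    move: ix; rewrite leq_eqVlt => /predU1P[->//|ix].
    by apply/ltW; apply: (sorted_ltn_nth lt_trans) => //;
      rewrite inE ?index_mem // (ltn_trans ix) ?index_mem.
  rewrite -(nth_take 0 xi) mem_nth // size_take; case: ifP => // _.
  by rewrite index_mem.
by rewrite size_take; case: ifP => H; move: ir H; clear; lia.
Qed.

Lemma nth_gt_card ys A t (z : int) (i : nat) : sorted <%R ys ->
  (forall x, A x -> x \in ys) -> (forall x, A x -> t < x) ->
  card_ge A z -> (i < size ys)%N -> (size ys)%:Z - z <= i%:Z -> t < nth 0 ys i.
Proof.
move=> sys Ays At /card_geP[r [ur rA zr]] iys iz; rewrite ltNge; apply/negP => ti.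
have : (size r <= size (drop i.+1 ys))%N.
  apply: uniq_leq_size => // x /rA Ax.
  have xys := Ays _ Ax; rewrite -(nth_index 0 xys).
  have xi : (i < index x ys)%N.
    rewrite ltnNge; apply/negP => ix.
    have := At _ Ax; rewrite ltNge -{1}(nth_index 0 xys) (le_trans _ ti) //.
    move: ix; rewrite leq_eqVlt => /predU1P[->//|ix].
    by apply/ltW; apply: (sorted_ltn_nth lt_trans) => //;
      rewrite inE ?index_mem // (ltn_trans ix) ?index_mem.
  have -> : index x ys = (i.+1 + (index x ys - i.+1))%N by rewrite subnKC.
  rewrite -nth_drop mem_nth // size_drop ltn_sub2r ?index_mem //.
  by apply: (leq_ltn_trans xi); rewrite index_mem.
by rewrite size_drop; move: iys iz zr; clear; lia.
Qed.

(** The points of ys are dealt out to u and v by the index functions [fu], [fv]. *)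
Lemma split_not_phaseless k (N1 N2 : int) (E : set R) ys
    (su sv : int) (lu lv : nat) (fu fv : nat -> nat) :
  N1 < N2 -> N1 - k.+1%:Z <= su -> su <= sv -> sv <= su + lu%:Z + k.+1%:Z ->
  su + lu%:Z <= N2 - 1 -> sv + lv%:Z <= N2 - 1 -> uniq ys ->
  (forall u, (u < lu)%N -> (fu u < size ys)%N) ->
  (forall u, (u < lv)%N -> (fv u < size ys)%N) ->
  (forall u v, (u < lu)%N -> (v < lu)%N -> fu u = fu v -> u = v) ->
  (forall u v, (u < lv)%N -> (v < lv)%N -> fv u = fv v -> u = v) ->
  (forall u, (u < lu)%N ->
     (su + u.+1%:Z)%:~R < nth 0 ys (fu u) < (su + u.+1%:Z + k.+1%:Z)%:~R) ->
  (forall u, (u < lv)%N ->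
     (sv + u.+1%:Z)%:~R < nth 0 ys (fv u) < (sv + u.+1%:Z + k.+1%:Z)%:~R) ->
  (forall i, (i < size ys)%N ->
     (exists2 u, (u < lu)%N & i = fu u) \/ (exists2 u, (u < lv)%N & i = fv u)) ->
  (forall x, E x -> [\/ x \in ys, x <= sv%:~R, (su + lu%:Z + k.+2%:Z)%:~R <= x |
     (sv + lv%:Z + k.+2%:Z)%:~R <= x]) ->
  ~ phaseless_sampling (@spline_space_on R k.+1 N1 N2) E.
Proof.
move=> N12 Nsu suv svu uN vN uys fus fvs fui fvi fuP fvP cover Eys.
apply: (@interlaced_not_phaseless R k N1 N2 E su sv lu lv
  (fun u => nth 0 ys (fu u)) (fun u => nth 0 ys (fv u))) => //.
- move=> u v ul vl /eqP; rewrite nth_uniq ?fus // => /eqP; exact: fui.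
- move=> u v ul vl /eqP; rewrite nth_uniq ?fvs // => /eqP; exact: fvi.
move=> x /Eys[xys|h|h|h]; [|by left|by right; left|by right; right; left].
do 3 right; have := cover (index x ys); rewrite index_mem xys => /(_ isT).
by move=> -[] [u ul E1]; [left|right]; exists u; rewrite // -E1 nth_index.
Qed.

Lemma int_lt_trans (a b : int) y : a <= b -> b%:~R < y -> a%:~R < y.
Proof. by move=> ab; apply: le_lt_trans; rewrite ler_int. Qed.

Lemma lt_int_trans (a b : int) y : a <= b -> y < a%:~R -> y < b%:~R.
Proof. by move=> ab h; apply: lt_le_trans h _; rewrite ler_int. Qed.

Lemma le_int_lt (a b : int) y : a < b -> y <= a%:~R -> y < b%:~R.
Proof. by move=> ab h; apply: le_lt_trans h _; rewrite ltr_int. Qed.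

Lemma int_lt_le (a b : int) y : a < b -> b%:~R <= y -> a%:~R < y.
Proof. by move=> ab; apply: lt_le_trans; rewrite ltr_int. Qed.

(** Let d = n2 - n1 be least among failing intervals, and pad the sample points to
    2 (d - 1).  The conditions on shorter intervals put the point of index 2 u
    into ]n1 + u, n1 + u + 1[ and the point of index 2 u + 1 into
    ]n1 + u + 1, n1 + u + 2[.  So the points of even index interlace for a spline
    that vanishes on the right of n2, and those of odd index for one that
    vanishes on the left of n1. *)
Lemma phaseless_inner k (N1 N2 : int) E (hN : N1 < N2) :
  phaseless_sampling (@spline_space_on R k.+1 N1 N2) E ->
  forall n1 n2 : int, N1 <= n1 -> n1 < n2 -> n2 <= N2 ->
    card_ge (E `&` `]n1%:~R, n2%:~R[) (2 * (n2 - n1) - 1).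
Proof.
move=> phaseless.
suff H (d : nat) : forall n1 n2 : int, N1 <= n1 -> n1 < n2 -> n2 <= N2 ->
    n2 - n1 = d%:Z -> card_ge (E `&` `]n1%:~R, n2%:~R[) (2 * (n2 - n1) - 1).
  move=> n1 n2 h1 h2 h3; apply: (H (absz (n2 - n1)%R)) => //.
  by move: h2; clear; lia.
elim/ltn_ind: d => d IH n1 n2 Nn1 n12 n2N dE.
apply: contrapT => /card_ltP[s [us sE ssz]].
have n12R : n1%:~R < n2%:~R :> R by rewrite ltr_int.
have [||||ys [sys szys sys_s ysA]] := @sorted_padding n1%:~R n2%:~R
    `]n1%:~R, n2%:~R[%classic s (2 * (d - 1))%N n12R.
- by move=> x xn; rewrite /= in_itv.
- exact: us.
- by move=> x /sE[].
- by move: ssz dE n12; clear; lia.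
have uys : uniq ys by move: sys; rewrite lt_sorted_uniq_le => /andP[].
have ysP i : (i < size ys)%N -> n1%:~R < nth 0 ys i < n2%:~R.
  by move=> /(mem_nth 0)/ysA; rewrite /= in_itv.
have inys x : E x -> n1%:~R < x < n2%:~R -> x \in ys.
  by move=> Ex xn; apply/sys_s/sE; split=> //=; rewrite in_itv.
have lt_nth (e i : nat) : (0 < e < d)%N -> (i.+1 <= 2 * e - 1)%N ->
    nth 0 ys i < (n1 + e%:Z)%:~R.
  move=> ed ie; apply: (@nth_lt_card ys (E `&` `]n1%:~R, (n1 + e%:Z)%:~R[)
    _ (2 * (n1 + e%:Z - n1) - 1)) => //.
  - move=> x [Ex]; rewrite /= in_itv /= => /andP[nx xn]; apply: inys => //.
    by rewrite nx (lt_trans xn) // ltr_int; move: ed dE; clear; lia.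
  - by move=> x [_]; rewrite /= in_itv /= => /andP[].
  - by apply: (IH e); move: ed dE Nn1 n2N; clear; lia.
  - by move: ie ed; clear; lia.
have gt_nth (e i : nat) : (0 < e < d)%N -> (2 * e - 1 <= i < 2 * (d - 1))%N ->
    (n1 + e%:Z)%:~R < nth 0 ys i.
  move=> ed ie; apply: (@nth_gt_card ys (E `&` `](n1 + e%:Z)%:~R, n2%:~R[)
    _ (2 * (n2 - (n1 + e%:Z)) - 1)) => //.
  - move=> x [Ex]; rewrite /= in_itv /= => /andP[nx xn]; apply: inys => //.
    by rewrite xn andbT (lt_trans _ nx) // ltr_int; move: ed dE; clear; lia.
  - by move=> x [_]; rewrite /= in_itv /= => /andP[].
  - by apply: (IH (d - e)%N); move: ed dE Nn1 n2N; clear; lia.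
  - by rewrite szys; move: ie; clear; lia.
  - by rewrite szys; move: ie ed dE; clear; lia.
apply: (@split_not_phaseless k N1 N2 E ys (n1 - k.+1%:Z) n1 (d - 1) (d - 1)
  (fun u => (2 * u)%N) (fun u => (2 * u + 1)%N)) phaseless => //;
  rewrite ?szys; try by move: Nn1 n12 n2N dE; clear; lia.
- move=> u ul; have /ysP/andP[h1 h2] : (2 * u < size ys)%N by rewrite szys; lia.
  apply/andP; split.
    case: (posnP u) => [u0|u0]; first by apply: int_lt_trans h1; move: u0; clear; lia.
    by apply: int_lt_trans (gt_nth u _ _ _); move: u0 ul; clear; lia.
  by apply: lt_int_trans (lt_nth u.+1 _ _ _); move: ul; clear; lia.
- move=> u ul; have /ysP/andP[h1 h2] : (2 * u + 1 < size ys)%N by rewrite szys; lia.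
  apply/andP; split.
    by apply: (gt_nth u.+1); move: ul; clear; lia.
  have [ud|du] := ltnP u.+2 d.
    by apply: lt_int_trans (lt_nth u.+2 _ _ _); move: ud; clear; lia.
  by apply: lt_int_trans h2; move: du dE ul; clear; lia.
- move=> i id; have [i_odd|i_even] := boolP (odd i); [right|left].
    by exists (i./2); move: id i_odd; clear; lia.
  by exists (i./2); move: id i_even; clear; lia.
move=> x Ex; have [h|h] := leP x n1%:~R; first by constructor 2.
have [h'|h'] := ltP x n2%:~R; first by constructor 1; apply: inys; rewrite ?h.
constructor 3; apply: le_trans h'; rewrite ler_int.
by move: dE n12; clear; lia.
Qed.

(** On a shortest failing interval [N1, N1 + d[ the first spline has d + k + 1
    coefficients and the second, which vanishes on the right of N1 + d, has d.
    The latter receives the points of odd index below 2 d - 2, and the former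
    the other points: that is what the minimum in its index function says. *)
Lemma phaseless_left k (N1 N2 : int) E (hN : N1 < N2) :
  phaseless_sampling (@spline_space_on R k.+1 N1 N2) E ->
  E `<=` `[N1%:~R, N2%:~R] ->
  forall d : int, 1 <= d <= N2 - N1 ->
    card_ge (E `&` `[N1%:~R, (N1 + d)%:~R[) (2 * d + k.+1%:Z - 1).
Proof.
move=> phaseless EN.
have E4 := phaseless_inner hN phaseless.
suff H (d : nat) : (0 < d)%N -> d%:Z <= N2 - N1 ->
    card_ge (E `&` `[N1%:~R, (N1 + d%:Z)%:~R[) (2 * d%:Z + k.+1%:Z - 1).
  by move=> d dN; have -> : d = (absz d)%:Z; [|apply: H]; move: dN; clear; lia.
elim/ltn_ind: d => d IH d0 dN.
apply: contrapT => /card_ltP[s [us sE ssz]].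
have N1d : N1%:~R < (N1 + d%:Z)%:~R :> R by rewrite ltr_int; move: d0; clear; lia.
have [||||ys [sys szys sys_s ysA]] := @sorted_padding N1%:~R (N1 + d%:Z)%:~R
    `[N1%:~R, (N1 + d%:Z)%:~R[%classic s (2 * d + k - 1)%N N1d.
- by move=> x /andP[x1 x2]; rewrite /= in_itv /= ltW.
- exact: us.
- by move=> x /sE[].
- by move: ssz d0; clear; lia.
have uys : uniq ys by move: sys; rewrite lt_sorted_uniq_le => /andP[].
have ysP i : (i < size ys)%N -> N1%:~R <= nth 0 ys i < (N1 + d%:Z)%:~R.
  by move=> /(mem_nth 0)/ysA; rewrite /= in_itv.
have inys x : E x -> N1%:~R <= x < (N1 + d%:Z)%:~R -> x \in ys.
  by move=> Ex xn; apply/sys_s/sE; split=> //=; rewrite in_itv.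
have lt_nth (e i : nat) : (0 < e < d)%N -> (i.+1 <= 2 * e + k)%N ->
    nth 0 ys i < (N1 + e%:Z)%:~R.
  move=> ed ie; apply: (@nth_lt_card ys (E `&` `[N1%:~R, (N1 + e%:Z)%:~R[)
    _ (2 * e%:Z + k.+1%:Z - 1)) => //.
  - move=> x [Ex]; rewrite /= in_itv /= => /andP[nx xn]; apply: inys => //.
    by rewrite nx (lt_trans xn) // ltr_int; move: ed; clear; lia.
  - by move=> x [_]; rewrite /= in_itv /= => /andP[].
  - by apply: IH; move: ed dN; clear; lia.
  - by move: ie ed; clear; lia.
have gt_nth (e i : nat) : (e < d)%N -> (2 * e + k <= i < 2 * d + k - 1)%N ->
    (N1 + e%:Z)%:~R < nth 0 ys i.
  move=> ed ie; apply: (@nth_gt_card ys (E `&` `](N1 + e%:Z)%:~R, (N1 + d%:Z)%:~R[)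
    _ (2 * (N1 + d%:Z - (N1 + e%:Z)) - 1)) => //.
  - move=> x [Ex]; rewrite /= in_itv /= => /andP[nx xn]; apply: inys => //.
    by rewrite xn andbT (le_trans _ (ltW nx)) // ler_int; clear; lia.
  - by move=> x [_]; rewrite /= in_itv /= => /andP[].
  - by apply: E4; move: ed dN; clear; lia.
  - by rewrite szys; move: ie; clear; lia.
  - by rewrite szys; move: ie ed; clear; lia.
(* The range of i covers both index functions chosen at the end. *)
have bounds (u i : nat) : (i < 2 * d + k - 1)%N -> (u < d + k)%N ->
    (2 * u <= i + k)%N -> ((u.+1 < d)%N -> (i <= 2 * u + 1)%N) ->
    (N1 - k.+1%:Z + u.+1%:Z)%:~R < nth 0 ys i <
    (N1 - k.+1%:Z + u.+1%:Z + k.+1%:Z)%:~R.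
  move=> id ud ui iu; have /ysP/andP[h1 h2] : (i < size ys)%N by rewrite szys.
  apply/andP; split.
    have [uk|ku] := ltnP u k; first by apply: int_lt_le h1; move: uk; clear; lia.
    by apply: int_lt_trans (gt_nth (u - k)%N _ _ _); move: id ud ui ku; clear; lia.
  have [ud'|du] := ltnP u.+1 d.
    have iu' := iu ud'.
    by apply: lt_int_trans (lt_nth u.+1 _ _ _); move: iu' ud'; clear; lia.
  by apply: lt_int_trans h2; move: du; clear; lia.
apply: (@split_not_phaseless k N1 N2 E ys (N1 - k.+1%:Z) (N1 - k.+1%:Z)
  (d + k) (d - 1) (fun u => minn (2 * u) (d + u - 1)) (fun u => (2 * u + 1)%N))
  phaseless => //;
  rewrite ?szys; try by move: d0 dN; clear; lia.
- by move=> u ul; apply: bounds; move: ul d0; clear; rewrite /=; lia.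
- by move=> u ul; apply: bounds; move: ul d0; clear; rewrite /=; lia.
- move=> i id; have [h|h] := leqP (2 * d - 1) i.
    by left; exists (i + 1 - d)%N; move: id h; clear; lia.
  have [i_odd|i_even] := boolP (odd i); [right|left].
    by exists (i./2); move: id i_odd h; clear; lia.
  by exists (i./2); move: id i_even h; clear; lia.
move=> x Ex; have [h'|h'] := ltP x (N1 + d%:Z)%:~R.
  constructor 1; apply: inys; rewrite ?h' ?andbT //.
  by have := EN _ Ex; rewrite /= in_itv /= => /andP[].
constructor 4; apply: le_trans h'; rewrite ler_int.
by move: d0; clear; lia.
Qed.

(** The mirror image of [phaseless_left]: here the second spline, which vanishes
    on the left of N2 - d, receives every other point from index k + 1 on, and
    the first one all the others. *)
Lemma phaseless_right k (N1 N2 : int) E (hN : N1 < N2) :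
  phaseless_sampling (@spline_space_on R k.+1 N1 N2) E ->
  E `<=` `[N1%:~R, N2%:~R] ->
  forall d : int, 1 <= d <= N2 - N1 ->
    card_ge (E `&` `](N2 - d)%:~R, N2%:~R]) (2 * d + k.+1%:Z - 1).
Proof.
move=> phaseless EN.
have E4 := phaseless_inner hN phaseless.
suff H (d : nat) : (0 < d)%N -> d%:Z <= N2 - N1 ->
    card_ge (E `&` `](N2 - d%:Z)%:~R, N2%:~R]) (2 * d%:Z + k.+1%:Z - 1).
  by move=> d dN; have -> : d = (absz d)%:Z; [|apply: H]; move: dN; clear; lia.
elim/ltn_ind: d => d IH d0 dN.
apply: contrapT => /card_ltP[s [us sE ssz]].
have N2d : (N2 - d%:Z)%:~R < N2%:~R :> R by rewrite ltr_int; move: d0; clear; lia.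
have [||||ys [sys szys sys_s ysA]] := @sorted_padding (N2 - d%:Z)%:~R N2%:~R
    `](N2 - d%:Z)%:~R, N2%:~R]%classic s (2 * d + k - 1)%N N2d.
- by move=> x /andP[x1 x2]; rewrite /= in_itv /= x1 ltW.
- exact: us.
- by move=> x /sE[].
- by move: ssz d0; clear; lia.
have uys : uniq ys by move: sys; rewrite lt_sorted_uniq_le => /andP[].
have ysP i : (i < size ys)%N -> (N2 - d%:Z)%:~R < nth 0 ys i <= N2%:~R.
  by move=> /(mem_nth 0)/ysA; rewrite /= in_itv.
have inys x : E x -> (N2 - d%:Z)%:~R < x <= N2%:~R -> x \in ys.
  by move=> Ex xn; apply/sys_s/sE; split=> //=; rewrite in_itv.
have gt_nth (e i : nat) : (0 < e < d)%N -> (2 * e - 1 <= i < 2 * d + k - 1)%N ->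
    (N2 - d%:Z + e%:Z)%:~R < nth 0 ys i.
  move=> ed ie; apply: (@nth_gt_card ys
    (E `&` `](N2 - (d - e)%N%:Z)%:~R, N2%:~R]) _
    (2 * (d - e)%N%:Z + k.+1%:Z - 1)) => //.
  - move=> x [Ex]; rewrite /= in_itv /= => /andP[nx xn]; apply: inys => //.
    by rewrite xn andbT (lt_trans _ nx) // ltr_int; move: ed; clear; lia.
  - move=> x [_]; rewrite /= in_itv /= => /andP[h _].
    by apply: int_lt_trans h; move: ed; clear; lia.
  - by apply: IH; move: ed dN; clear; lia.
  - by rewrite szys; move: ie; clear; lia.
  - by rewrite szys; move: ie ed; clear; lia.
have lt_nth (e i : nat) : (0 < e <= d)%N -> (i.+1 <= 2 * e - 1)%N ->
    nth 0 ys i < (N2 - d%:Z + e%:Z)%:~R.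
  move=> ed ie; apply: (@nth_lt_card ys
    (E `&` `](N2 - d%:Z)%:~R, (N2 - d%:Z + e%:Z)%:~R[)
    _ (2 * (N2 - d%:Z + e%:Z - (N2 - d%:Z)) - 1)) => //.
  - move=> x [Ex]; rewrite /= in_itv /= => /andP[nx xn]; apply: inys => //.
    by rewrite nx (le_trans (ltW xn)) // ler_int; move: ed; clear; lia.
  - by move=> x [_]; rewrite /= in_itv /= => /andP[].
  - by apply: E4; move: ed dN; clear; lia.
  - by move: ie ed; clear; lia.
(* Past N2 the bound holds because all points are at most N2. *)
have upper (e i : nat) : (0 < e)%N -> (i < 2 * d + k - 1)%N ->
    ((e <= d)%N -> (i.+1 <= 2 * e - 1)%N) -> nth 0 ys i < (N2 - d%:Z + e%:Z)%:~R.
  move=> e0 id ie; have /ysP/andP[h1 h2] : (i < size ys)%N by rewrite szys.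
  have [ed|de] := leqP e d; first by apply: lt_nth (ie ed); rewrite e0.
  by apply: le_int_lt h2; move: de; clear; lia.
have lower (e : int) (i : nat) : (i < 2 * d + k - 1)%N -> e < d%:Z ->
    2 * e - 1 <= i%:Z -> (N2 - d%:Z + e)%:~R < nth 0 ys i.
  move=> id ed ei; have /ysP/andP[h1 h2] : (i < size ys)%N by rewrite szys.
  have [e0|e0] := leP e 0; first by apply: int_lt_trans h1; move: e0; clear; lia.
  by have -> : e = (absz e)%:Z; [|apply: gt_nth]; move: id ed ei e0; clear; lia.
apply: (@split_not_phaseless k N1 N2 E ys (N2 - d%:Z - k.+1%:Z) (N2 - d%:Z)
  (d + k) (d - 1) (fun u => maxn u (2 * u - k)) (fun u => (2 * u + k.+1)%N))
  phaseless => //;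
  rewrite ?szys; try by move: d0 dN; clear; lia.
- move=> u ul; rewrite -!(addrA (N2 - d%:Z)); apply/andP; split.
    by apply: lower; move: ul d0; clear; lia.
  have -> : - k.+1%:Z + u.+1%:Z + k.+1%:Z = u.+1%:Z by clear; lia.
  by apply: upper; move: ul d0; clear; lia.
- move=> u ul; rewrite -!(addrA (N2 - d%:Z)) -PoszD; apply/andP; split.
    by apply: lower; move: ul d0; clear; lia.
  by apply: upper; move: ul d0; clear; lia.
- move=> i id; have [h|h] := leqP i k.
    by left; exists i; move: id h; clear; lia.
  have [i_odd|i_even] := boolP (odd (i - k)); [right|left].
    by exists ((i - k)./2); move: id i_odd h; clear; lia.
  by exists ((i + k)./2); move: id i_even h; clear; lia.
move=> x Ex; have [h'|h'] := leP x (N2 - d%:Z)%:~R; first by constructor 2.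
constructor 1; apply: inys; rewrite ?h' //=.
by have := EN _ Ex; rewrite /= in_itv /= => /andP[].
Qed.

(** Both splines use all the coefficients of [N1, N2], and the points are dealt
    out alternately; the one-sided conditions give the interlacing. *)
Lemma phaseless_total k (N1 N2 : int) E (hN : N1 < N2) :
  phaseless_sampling (@spline_space_on R k.+1 N1 N2) E ->
  E `<=` `[N1%:~R, N2%:~R] -> card_ge E (2 * (N2 - N1 + k.+1%:Z) - 1).
Proof.
move=> phaseless EN.
have E2 := phaseless_left hN phaseless EN.
have E3 := phaseless_right hN phaseless EN.
have [d dE] : exists d : nat, N2 - N1 = d%:Z.
  by exists (absz (N2 - N1)%R); move: hN; clear; lia.
have d0 : (0 < d)%N by move: dE hN; clear; lia.
apply: contrapT => /card_ltP[s [us sE ssz]].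
have N12R : N1%:~R < N2%:~R :> R by rewrite ltr_int.
have [||||ys [sys szys sys_s ysA]] := @sorted_padding N1%:~R N2%:~R
    `[N1%:~R, N2%:~R]%classic s (2 * (d + k))%N N12R.
- by move=> x /andP[x1 x2]; rewrite /= in_itv /= !ltW.
- exact: us.
- by move=> x /sE/EN.
- by move: ssz dE; clear; lia.
have uys : uniq ys by move: sys; rewrite lt_sorted_uniq_le => /andP[].
have ysP i : (i < size ys)%N -> N1%:~R <= nth 0 ys i <= N2%:~R.
  by move=> /(mem_nth 0)/ysA; rewrite /= in_itv.
have inys x : E x -> x \in ys by move=> Ex; apply/sys_s/sE.
have bounds (u i : nat) : (u < d + k)%N -> (2 * u <= i <= 2 * u + 1)%N ->
    (N1 - k.+1%:Z + u.+1%:Z)%:~R < nth 0 ys i <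
    (N1 - k.+1%:Z + u.+1%:Z + k.+1%:Z)%:~R.
  move=> ud ui; have isz : (i < size ys)%N by rewrite szys; move: ud ui; clear; lia.
  have /andP[h1 h2] := ysP i isz.
  apply/andP; split.
    have [uk|ku] := ltnP u k; first by apply: int_lt_le h1; move: uk; clear; lia.
    have dk : 1 <= (d + k - u)%N%:Z <= N2 - N1 by move: ud ku dE; clear; lia.
    apply: (@nth_gt_card ys _ _ _ i sys _ _ (E3 _ dk)) => //.
    - by move=> x [Ex _]; apply: inys.
    - move=> x [_]; rewrite /= in_itv /= => /andP[h _].
      by apply: int_lt_trans h; move: ud ku dE; clear; lia.
    - by rewrite szys; move: ud ui ku; clear; lia.
  have [ud'|du] := leqP u.+1 d.
    have dk : 1 <= u.+1%:Z <= N2 - N1 by move: ud' dE; clear; lia.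
    apply: (@nth_lt_card ys _ _ _ i sys _ _ (E2 _ dk)) => //.
    - by move=> x [Ex _]; apply: inys.
    - move=> x [_]; rewrite /= in_itv /= => /andP[_ h].
      by apply: lt_int_trans h; clear; lia.
    - by move: ui; clear; lia.
  by apply: le_int_lt h2; move: du dE; clear; lia.
apply: (@split_not_phaseless k N1 N2 E ys (N1 - k.+1%:Z) (N1 - k.+1%:Z)
  (d + k) (d + k) (fun u => (2 * u)%N) (fun u => (2 * u + 1)%N))
  phaseless => //;
  rewrite ?szys; try by move: d0 dE; clear; lia.
- by move=> u ul; apply: bounds; move: ul d0; clear; rewrite /=; lia.
- by move=> u ul; apply: bounds; move: ul d0; clear; rewrite /=; lia.
- move=> i id; have [i_odd|i_even] := boolP (odd i); [right|left].
    by exists (i./2); move: id i_odd; clear; lia.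
  by exists (i./2); move: id i_even; clear; lia.
by move=> x Ex; constructor 1; apply: inys.
Qed.

End Necessity.

(** * The characterization *)

(** The product (f + g) (f - g) vanishes everywhere, so if neither factor were 0
    the halves of f + g and f - g would separate f. *)
Lemma sampling_sufficient (R : realType) k (N1 N2 : int) (E : set R) :
  N1 < N2 -> E `<=` `[N1%:~R, N2%:~R] -> sampling_conditions k.+1 N1 N2 E ->
  phaseless_sampling (@spline_space_on R k.+1 N1 N2) E.
Proof.
move=> N12 EN Econd f g [F /spline_spaceE[c1 ->] fE] nsep [G /spline_spaceE[c2 ->] gE] fg.
pose I := \1_(`[N1%:~R, N2%:~R]) : R -> R.
have Iin x : N1%:~R <= x <= N2%:~R -> I x = 1.
  by move=> xN; rewrite /I indicE mem_set //= in_itv.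
have prod0 := @sampled_abs_eq R k N1 N2 E c1 c2 N12 EN Econd.
have {}prod0 x : (f x + g x) * (f x - g x) = 0.
  rewrite fE gE -mulrDl -mulrBl mulrACA -[(\1_ _) x]/(I x).
  have [xN|xN] := boolP (N1%:~R <= x <= N2%:~R).
    rewrite prod0 ?mul0r // => y Ey; have := fg y Ey.
    have yN : N1%:~R <= y <= N2%:~R by have := EN _ Ey; rewrite /= in_itv.
    by rewrite fE gE -[(\1_ _) y]/(I y) Iin // !mulr1.
  rewrite /I indicE memNset ?mul0r ?mulr0 //=.
  by rewrite in_itv /=; apply/negP.
have inH a b : spline_space_on k.+1 N1 N2 (fun x => a * f x + b * g x).
  exists (spl k.+1 (fun n => a * c1 n + b * c2 n)).
    by apply/spline_spaceE; eexists.
  by apply/funext => x; rewrite spl_lin fE gE mulrDl !mulrA.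
apply: contrapT => /not_orP[gf gNf]; apply: nsep.
exists (fun x => 2^-1 * f x + 2^-1 * g x), (fun x => 2^-1 * f x + (- 2^-1) * g x).
split.
- split; first exact: inH.
  move=> h; apply: gNf; apply/funext => x.
  have : 2^-1 * f x + 2^-1 * g x = 0 := congr1 (fun f => f x) h.
  by rewrite /=; lra.
- split; first exact: inH.
  move=> h; apply: gf; apply/funext => x.
  have : 2^-1 * f x + (- 2^-1) * g x = 0 := congr1 (fun f => f x) h.
  by lra.
- by apply/funext => x /=; lra.
move=> x; have -> : (2^-1 * f x + 2^-1 * g x) * (2^-1 * f x + - 2^-1 * g x) =
   (2^-1 * 2^-1) * ((f x + g x) * (f x - g x)) by ring.
by rewrite prod0 mulr0.
Qed.

(* A sequence of distinct points, finite or infinite, is a countable set. *)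
Theorem theorem1p2 (R : realType) (m : nat) (N1 N2 : int) (E : set R)
    (hm : (1 <= m)%N) (hN : N1 < N2)
    (Ecount : countable E) (EN : E `<=` `[N1%:~R, N2%:~R]) :
  (phaseless_sampling (spline_space_on m N1 N2) E <->
     sampling_conditions m N1 N2 E) /\
  (sampling_conditions m N1 N2 E ->
   forall f1 f2 : R -> R, spline_space m f1 -> spline_space m f2 ->
     (forall x, E x -> `|f1 x| = `|f2 x|) ->
     forall x, N1%:~R <= x <= N2%:~R -> `|f1 x| = `|f2 x|).
Proof.
case: m hm => // k _; split; first split.
- move=> phaseless; split.
  + exact: (phaseless_total hN phaseless EN).
  + exact: (phaseless_left hN phaseless EN).
  + exact: (phaseless_right hN phaseless EN).
  + exact: (phaseless_inner hN phaseless).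
- exact: sampling_sufficient.
move=> Econd f1 f2 /spline_spaceE[c1 ->] /spline_spaceE[c2 ->] fE x xN.
have /eqP := sampled_abs_eq hN EN Econd fE xN.
rewrite mulf_eq0 addr_eq0 subr_eq0 => /orP[] /eqP -> //.
by rewrite normrN.
Qed.
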